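(* For $k\in(0,1)$, $h>0$ and $f\in L^1_{1,1}(\mathbb{R})$, there hold the sharp inequalities $$\left\|D^k_-f\right\|_{L_1(\mathbb{R})}\leqslant\frac{2h^{-k}\|f\|_{L_1(\mathbb{R})}}{\Gamma(1-k)}+\frac{kh^{1-k}\|f'\|_{L_1(\mathbb{R})}}{\Gamma(2-k)},$$ $$\left\|D^k_-f\right\|_{L_1(\mathbb{R})}\leqslant\frac{2^{1-k}}{\Gamma(2-k)}\,\|f\|_{L_1(\mathbb{R})}^{1-k}\,\|f'\|_{L_1(\mathbb{R})}^{k}.$$
   Context: $L^1_{1,1}(\mathbb{R})$ is the space of locally absolutely continuous $f\in L_1(\mathbb{R})$ with $f'\in L_1(\mathbb{R})$. Marchaud derivative: for $k>0$, $k\notin\mathbb{N}$, $f:\mathbb{R}\to\mathbb{R}$, $x\in\mathbb{R}$, $D^k_-f(x)=\frac{1}{\varkappa(k,n)}\int_0^{+\infty}\frac{(\Delta^n_{-t}f)(x)}{t^{1+k}}\,dt$, where $n\in\mathbb{N}$, $n>k$ (the definition does not depend on $n$), $(\Delta^n_{-t}f)(x)=\sum_{m=0}^n(-1)^m\binom{n}{m}f(x+mt)$ and $\varkappa(k,n)=\Gamma(-k)\sum_{m=0}^n(-1)^m\binom{n}{m}m^k$. ''Sharp'' means that the constants on the right-hand side cannot be replaced by smaller ones. *)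

(* Defs.v *)
From HB Require Import structures.
From mathcomp Require Import all_boot all_order all_algebra.
From mathcomp Require Import all_classical all_reals all_analysis.
Set Implicit Arguments.
Unset Strict Implicit.
Unset Printing Implicit Defensive.
Import Order.TTheory GRing.Theory Num.Theory.
Import numFieldNormedType.Exports.
Local Open Scope classical_set_scope.
Local Open Scope ring_scope.

Definition abs_continuous_on (R : realType) (a b : R) (f : R -> R) : Prop :=
  forall e : R, 0 < e -> exists2 d : R, 0 < d &
    forall (N : nat) (l r : 'I_N -> R),
      (forall i, a <= l i /\ l i <= r i /\ r i <= b) ->
      trivIset [set: 'I_N] (fun i => [set` `]l i, r i[]) ->
      \sum_(i < N) (r i - l i) < d ->
      \sum_(i < N) `|f (r i) - f (l i)| < e.

Definition loc_abs_continuous (R : realType) (f : R -> R) : Prop :=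
  forall a b : R, a < b -> abs_continuous_on a b f.

(* The space L^1_{1,1}(R). For a continuous f, the library's total derivative
   derive1 f is a Borel function (it takes one fixed value wherever f is not
   derivable), so membership in Lfun only constrains its integral. *)
Definition L1_11 (R : realType) (f : R -> R) : Prop :=
  [/\ loc_abs_continuous f,
      f \in Lfun (@lebesgue_measure R) 1%:E &
      derive1 f \in Lfun (@lebesgue_measure R) 1%:E].

(* Euler's integral, meaningful for 0 < s. *)
Definition Gamma_integral (R : realType) (s : R) : R :=
  \int[@lebesgue_measure R]_(t in `]0, +oo[) (t `^ (s - 1) * expR (- t)).

(* The Gamma function on R minus the poles 0, -1, -2, ...: Euler's integral for
   0 < s, continued by Gamma(s) = Gamma(s + m) / (s (s + 1) ... (s + m - 1)).
   At the poles the product vanishes and the value is 0 by convention. *)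
Definition Gamma (R : realType) (s : R) : R :=
  let m := if 0 < s then 0%N else (Num.truncn (- s)).+1 in
  Gamma_integral (s + m%:R) / \prod_(i < m) (s + i%:R).

Definition varkappa (R : realType) (k : R) (n : nat) : R :=
  Gamma (- k) * \sum_(m < n.+1) (-1) ^+ m * 'C(n, m)%:R * (m%:R : R) `^ k.

(* (Delta^n_{-t} f)(x) *)
Definition Delta_minus (R : realType) (n : nat) (t : R) (f : R -> R) (x : R)
    : R :=
  \sum_(m < n.+1) (-1) ^+ m * 'C(n, m)%:R * f (x + m%:R * t).

(* D^k_- f, computed with differences of order n > k. It is extended-real
   valued: a finite value at x means that the integral converges absolutely;
   otherwise the value is infinite, so a finite L_1-norm forces absolute
   convergence for almost every x. *)
Definition marchaud (R : realType) (k : R) (n : nat) (f : R -> R) (x : R)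
    : \bar R :=
  (((varkappa k n)^-1)%:E *
   \int[@lebesgue_measure R]_(t in `]0%R, +oo[)
     (Delta_minus n t f x / t `^ (1 + k))%:E)%E.

Definition L1norm (R : realType) (g : R -> \bar R) : \bar R :=
  'N[@lebesgue_measure R]_1[g]%E.

Definition additive_ineq (R : realType) (k : R) (n : nat) (A B : R) : Prop :=
  forall f : R -> R, L1_11 f ->
    (L1norm (marchaud k n f) <=
       A%:E * L1norm (EFin \o f) + B%:E * L1norm (EFin \o derive1 f))%E.

Definition multiplicative_ineq (R : realType) (k : R) (n : nat) (C : R)
    : Prop :=
  forall f : R -> R, L1_11 f ->
    (L1norm (marchaud k n f) <=
       C%:E * (L1norm (EFin \o f) `^ (1 - k) * L1norm (EFin \o derive1 f) `^ k))%E.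

(* Main.v *)
(**
An absolutely continuous [f] satisfies
[|f b - f a| <= \int_(a, b] |f'|]: its variation function and the difference of
the two are monotone and absolutely continuous, so their Stieltjes measures have
Lebesgue densities (Radon-Nikodym), and Lebesgue differentiation identifies the
resulting density of [f] with [f'] almost everywhere. By Tonelli,
[\int |f x - f (x + t)| dx <= min (2 ||f||, t ||f'||)]; splitting the integral
against [t^-(1 + k)] at [t = h] gives the additive inequality, and optimizing
over [h] the multiplicative one. Differences of order [n] reduce to order 1
because the dilation [t -> m t] multiplies [\int (f (x + t) - f x) t^-(1 + k) dt]
by [m^k].

Sharpness: let [f] be the trapezoid of height 1 on [[e, h]] supported in
[[0, h + e]]. As [D^k_- f] has integral 0, its [L_1] norm is at least twice its
integral over [[e, h]]; there it is bounded below using only the [t > h + e - x],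
where [f (x + t) = 0]. Letting [e -> 0] gives equality in both inequalities.
*)
Require Import Defs.
From HB Require Import structures.
From mathcomp Require Import all_boot all_order all_algebra.
From mathcomp Require Import all_classical all_reals all_analysis.
From mathcomp Require Import measurable_realfun ring lra.
Set Implicit Arguments.
Unset Strict Implicit.
Unset Printing Implicit Defensive.
Import Order.TTheory GRing.Theory Num.Theory.
Import numFieldNormedType.Exports.
Local Open Scope classical_set_scope.
Local Open Scope ring_scope.

(** * Increments of absolutely continuous functions *)

Section interval_lists.
Variable R : realType.
Implicit Types (a b e d x y : R) (f F : R -> R) (p q : R * R) (s t : seq (R * R)).

(** The natural extremal is the indicator of [[0, h]], which is not absolutely continuous; the
    trapezoids approximate it, with [||f'|| = 2] and [||f||] tending to [h]. Nothing is lost in the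
    limit: the derivative of the indicator is nonnegative on the interval and nonpositive off it, so
    its norm is exactly twice its integral over the interval. For these norms the step
    [2 ||f|| / ||f'||] that minimizes the additive bound tends to [h], which is why one family is
    extremal for both inequalities. A single relation, [A h + 2 B <= A' h + 2 B'], then settles both
    additive constants, since [A' <= A] and [B' <= B]. Two points need care in the reduction from
    order [n] to order 1. The integrals converge absolutely only for almost every [x], so the
    formula for [D^k_- f] is an almost everywhere identity, deduced from integrability of the kernel
    on the product. Also, [varkappa] is inverted, so it has to be nonzero; this follows from the
    same dilation identity, applied to [1 - exp (- t)]. *)

Definition itv_apart p q := (p.2 <= q.1) || (q.2 <= p.1).

Definition apart_itvs a b s :=
  all (fun p => [&& a <= p.1, p.1 <= p.2 & p.2 <= b]) s && pairwise itv_apart s.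

Definition total_length s := \sum_(p <- s) (p.2 - p.1).

Definition increments f s := \sum_(p <- s) `|f p.2 - f p.1|.

(** Lists make it easy to subdivide one interval and concatenate the rest. The bound [<= e], unlike
    [< e], survives the supremum over partitions that defines the total variation. *)
Definition list_ac a b f := forall e, 0 < e -> exists2 d, 0 < d &
  forall s, apart_itvs a b s -> total_length s < d -> increments f s <= e.

Lemma itv_apart_sym : symmetric itv_apart.
Proof. by move=> p q; rewrite /itv_apart orbC. Qed.

Lemma abs_continuous_list a b f : abs_continuous_on a b f -> list_ac a b f.
Proof.
move=> acf e /acf[d d0 dP]; exists d => // s /andP[/allP abs /pairwiseP sep] sd.
pose l (i : 'I_(size s)) := (nth (0, 0) s i).1.
pose r (i : 'I_(size s)) := (nth (0, 0) s i).2.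
have := dP _ l r; rewrite /increments /total_length in sd *.
rewrite (big_nth (0, 0)) big_mkord => H; apply/ltW/H => {H}.
- by move=> i; have /abs/and3P[] := mem_nth (0, 0) (ltn_ord i).
- move=> i j _ _ [x []]; rewrite /= !in_itv/= => /andP[lix xri] /andP[ljx xrj].
  apply/eqP; apply/negPn/negP => ij.
  wlog ltij : i j ij lix xri ljx xrj / (i < j)%N.
    move=> W; have [|] := ltnP i j; first exact: W.
    rewrite leq_eqVlt => /predU1P[/val_inj ji|ji]; first by rewrite ji eqxx in ij.
    by apply: (W j i) => //; rewrite eq_sym.
  have /(_ (0,0) i j (ltn_ord i) (ltn_ord j) ltij) := sep.
  rewrite /itv_apart => /orP[h|h].
    by have := lt_trans ljx xri; rewrite ltNge h.
  by have := lt_trans lix xrj; rewrite ltNge h.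
- by move: sd; rewrite (big_nth (0, 0)) big_mkord.
Qed.

Fixpoint itv_pairs x (u : seq R) :=
  if u is y :: u' then (x, y) :: itv_pairs y u' else [::].

Lemma itv_pairsP x y (u : seq R) p : itv_partition x y u -> p \in itv_pairs x u ->
  [&& x <= p.1, p.1 <= p.2 & p.2 <= y].
Proof.
elim: u x => // z u ih x H; have xz := itv_partition_cons H.
have {}H : x <= z by case: H => /= /andP[/ltW].
rewrite inE => /predU1P[->/=|/(ih _ xz)/and3P[zp -> ->]].
  by rewrite lexx H (itv_partition_le xz).
by rewrite (le_trans H).
Qed.

Lemma itv_pairs_apart x y (u : seq R) : itv_partition x y u ->
  pairwise itv_apart (itv_pairs x u).
Proof.
elim: u x => // z u ih x H; have xz := itv_partition_cons H.
rewrite /= ih// andbT; apply/allP => p /(itv_pairsP xz)/and3P[zp _ _].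
by rewrite /itv_apart/= zp.
Qed.

Lemma total_length_pairs x y (u : seq R) : itv_partition x y u ->
  total_length (itv_pairs x u) = y - x.
Proof.
rewrite /total_length.
elim: u x => [x /itv_partition_nil ->|z u ih x H]; first by rewrite big_nil subrr.
by rewrite /= big_cons (ih _ (itv_partition_cons H))/= addrC subrKA.
Qed.

Lemma variation_pairs x y f (u : seq R) : itv_partition x y u ->
  variation x y f u = increments f (itv_pairs x u).
Proof.
move=> H; rewrite variation_zip // /increments.
by elim: u x H => [|z u ih] x H; rewrite /= ?big_nil// !big_cons/= (ih _ (itv_partition_cons H)).
Qed.

Lemma apart_itvs_cons a b p s : apart_itvs a b (p :: s) =
  [&& a <= p.1, p.1 <= p.2, p.2 <= b, all (itv_apart p) s & apart_itvs a b s].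
Proof. by rewrite /apart_itvs/= -!andbA; do 3!congr andb; rewrite [LHS]andbCA. Qed.

Lemma apart_itvs_cat a b s t : apart_itvs a b (s ++ t) =
  [&& apart_itvs a b s, apart_itvs a b t & allrel itv_apart s t].
Proof.
rewrite /apart_itvs all_cat pairwise_cat.
by case: (all _ s); case: (all _ t); case: (allrel _ _ _); case: (pairwise _ s); case: (pairwise _ t).
Qed.

(* [s] lists the intervals already replaced by their total variation, [t] the
   subdivided ones: the induction on [s] refines one interval at a time. *)
Lemma sum_total_variation a b f e d :
  (forall s, apart_itvs a b s -> total_length s < d -> increments f s <= e) ->
  forall s t, apart_itvs a b (s ++ t) -> total_length (s ++ t) < d ->
  (\sum_(p <- s) total_variation p.1 p.2 f + (increments f t)%:E <= e%:E)%E.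
Proof.
move=> H; elim => [|p s ih] t.
  by move=> st std; rewrite big_nil add0e lee_fin; exact: H.
rewrite cat_cons apart_itvs_cons => /and5P[ap p12 pb pst st] lst.
have lst' : total_length (s ++ t) < d.
  by apply: le_lt_trans lst; rewrite /total_length big_cons lerDr subr_ge0.
rewrite big_cons -addeA; set X := (X in (_ + X)%E).
have X0 : (0 <= X)%E.
  rewrite /X adde_ge0 ?lee_fin ?sumr_ge0//.
  rewrite big_seq; apply: sume_ge0 => q qs; apply: total_variation_ge0.
  by case/andP: st => /allP /(_ q); rewrite mem_cat qs => /(_ isT)/and3P[].
have Xfin : X \is a fin_num.
  by rewrite ge0_fin_numE// (le_lt_trans (ih _ st lst'))// ltry.
(* Since [X] is finite it can be moved to the right, and the variation over [p] is then bounded one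
   partition [u] at a time; the cells of [u] join the subdivided intervals. *)
rewrite -leeBrDr//; apply: ge_ereal_sup => _ [_ [u pu <-] <-].
rewrite leeBrDr// /X addeCA -EFinD (variation_pairs f pu).
have -> : increments f (itv_pairs p.1 u) + increments f t = increments f (itv_pairs p.1 u ++ t).
  by rewrite /increments big_cat.
apply: ih.
- move: (st); rewrite !apart_itvs_cat allrel_catr => /and3P[-> tt ->].
  rewrite tt !andbT/=.
  move: pst; rewrite all_cat => /andP[ps pt].
  have pin q := @itv_pairsP _ _ _ q pu.
  have sub (q r : R * R) : q \in itv_pairs p.1 u -> itv_apart p r -> itv_apart q r.
    move=> /pin/and3P[h1 h2 h3] /orP[h|h]; rewrite /itv_apart.
      by rewrite (le_trans h3 h).
    by rewrite (le_trans h h1) orbT.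
  apply/andP; split.
  + apply/andP; split.
    * apply/andP; split; last exact: itv_pairs_apart pu.
      apply/allP => q /pin/and3P[h1 -> h3].
      by rewrite (le_trans ap h1) (le_trans h3 pb).
    * apply/allrelP => q r qu rt; apply: sub qu _.
      by move/allP : pt; apply.
  + apply/allrelP => r q rs qu; rewrite itv_apart_sym; apply: sub qu _.
    by move/allP : ps; apply.
- move: lst; rewrite /total_length big_cons !big_cat/= -(total_length_pairs pu) /total_length.
  by rewrite addrCA.
Qed.

(** Subdividing intervals does not change their total length, so the [d] that controls increments
    controls variations too. *)
Lemma list_ac_total_variation a b f e : list_ac a b f -> 0 < e ->
  exists2 d, 0 < d & forall s, apart_itvs a b s -> total_length s < d ->
    (\sum_(p <- s) total_variation p.1 p.2 f <= e%:E)%E.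
Proof.
move=> acf /acf[d d0 dP]; exists d => // s abs sd.
have := sum_total_variation dP (s := s) (t := [::]).
rewrite cats0 => /(_ abs sd); apply: le_trans.
by rewrite leeDl// lee_fin /increments big_nil.
Qed.

Lemma apart_itvs1 a b x y : apart_itvs a b [:: (x, y)] = [&& a <= x, x <= y & y <= b].
Proof. by rewrite /apart_itvs/= !andbT. Qed.

Lemma total_length1 x y : total_length [:: (x, y)] = y - x.
Proof. by rewrite /total_length big_seq1. Qed.

(** Cut [[a, b]] into equal pieces shorter than the [d] belonging to [e = 1]; each piece has
    variation at most 1, and variation is additive. *)
Lemma list_ac_bounded a b f : a <= b -> list_ac a b f ->
  total_variation a b f \is a fin_num.
Proof.
move=> ab /list_ac_total_variation/(_ ltr01)[d d0 dP].
have [n nP] : exists n : nat, (b - a) / d < n.+1%:R.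
  exists (Num.truncn ((b - a) / d)); apply: truncnS_gt.
pose c i : R := a + (b - a) * (i%:R / n.+1%:R).
have cS i : c i <= c i.+1.
  by rewrite lerD2l ler_wpM2l ?subr_ge0// ler_pM2r ?invr_gt0// ler_nat.
have cd i : c i.+1 - c i < d.
  have -> : c i.+1 - c i = (b - a) / n.+1%:R by rewrite /c -addn1 natrD; ring.
  by rewrite ltr_pdivrMr// mulrC -ltr_pdivrMr.
have c0 : c 0%N = a by rewrite /c mul0r mulr0 addr0.
have cn : c n.+1 = b by rewrite /c divff ?pnatr_eq0// mulr1 addrC subrK.
have ca i : a <= c i by elim: i => [|i ih]; rewrite ?c0// (le_trans ih).
have cb i : (i <= n.+1)%N -> c i <= b.
  move=> im; rewrite -cn lerD2l ler_wpM2l ?subr_ge0// ler_pM2r ?invr_gt0//.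
  by rewrite ler_nat.
rewrite -cn ge0_fin_numE ?total_variation_ge0//.
suff H i : (i <= n.+1)%N -> (total_variation a (c i) f <= i%:R%:E)%E.
  by rewrite (le_lt_trans (H _ (leqnn _)))// ltry.
elim: i => [_|i ih im]; first by rewrite c0 total_variationxx.
rewrite (total_variationD f (ca i) (cS i)) -natr1 EFinD leeD ?ih//.
  by rewrite ltnW.
have := dP [:: (c i, c i.+1)].
by rewrite apart_itvs1 total_length1 big_seq1; apply; rewrite ?ca ?cS ?cb ?cd.
Qed.

(** Additivity of the variation. Finiteness is returned as well, because [fine] would turn an
    infinite variation into 0. *)
Lemma fine_total_variationB a b f x y : a <= x -> x <= y -> y <= b -> list_ac a b f ->
  fine (total_variation a y f) - fine (total_variation a x f) =
  fine (total_variation x y f) /\ total_variation x y f \is a fin_num.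
Proof.
move=> ax xy yb acf; have ay := le_trans ax xy.
have fin : total_variation a y f \is a fin_num.
  have := list_ac_bounded (le_trans ay yb) acf.
  rewrite (total_variationD f ay yb).
  by rewrite fin_numD => /andP[].
have := fin; rewrite (total_variationD f ax xy) fin_numD => /andP[fx fxy]; split => //.
by rewrite fineD// addrC addKr.
Qed.

Lemma list_ac_variation a b f : list_ac a b f ->
  list_ac a b (fun x => fine (total_variation a x f)).
Proof.
move=> acf e e0; have [d d0 dP] := list_ac_total_variation acf e0.
exists d => // s abs /(dP _ abs) H; rewrite -lee_fin; apply: le_trans H.
rewrite /increments -sumEFin big_seq [leRHS]big_seq; apply: lee_sum => p ps.
have /and3P[ap p12 pb] : [&& a <= p.1, p.1 <= p.2 & p.2 <= b].
  by case/andP: abs => /allP /(_ p ps).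
have [-> fin] := fine_total_variationB ap p12 pb acf.
by rewrite ger0_norm ?fineK// fine_ge0// total_variation_ge0.
Qed.

Lemma list_acB a b f F : list_ac a b f -> list_ac a b F ->
  list_ac a b (fun x => f x - F x).
Proof.
move=> acf acF e e0; have e2 : 0 < e / 2 by rewrite divr_gt0.
have [d1 d10 dP1] := acf _ e2; have [d2 d20 dP2] := acF _ e2.
exists (Num.min d1 d2); first by rewrite lt_min d10.
move=> s abs; rewrite lt_min => /andP[/(dP1 _ abs) h1 /(dP2 _ abs) h2].
rewrite (splitr e); apply: le_trans (lerD h1 h2).
rewrite /increments -big_split/=; apply: ler_sum => p _.
have -> : f p.2 - F p.2 - (f p.1 - F p.1) = (f p.2 - f p.1) - (F p.2 - F p.1).
  by ring.
exact: ler_normB.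
Qed.

Definition clamp a b x := Num.max a (Num.min x b).

Lemma clamp_ge a b x : a <= clamp a b x.
Proof. by rewrite le_max lexx. Qed.

Lemma clamp_le a b x : a <= b -> clamp a b x <= b.
Proof. by move=> ab; rewrite ge_max ab ge_min lexx orbT. Qed.

Lemma clamp_homo a b : {homo clamp a b : x y / x <= y}.
Proof.
move=> x y xy; rewrite /clamp ge_max !le_max lexx/=.
by rewrite le_min !ge_min xy lexx !orbT.
Qed.

Lemma clamp_id a b x : a <= x <= b -> clamp a b x = x.
Proof. by move=> /andP[ax xb]; rewrite /clamp (min_idPl xb) (max_idPr ax). Qed.

Lemma clampB a b x y : x <= y -> clamp a b y - clamp a b x <= y - x.
Proof.
move=> xy; rewrite /clamp /Num.max /Num.min.
by do ! case: ifPn; rewrite -?leNgt; lra.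
Qed.

(** Absolute continuity on the whole line with one [d]. Composition with [clamp] extends a function
    from [[a, b]] by constants, which gives a function on the line fit to define a Stieltjes
    measure. *)
Definition global_ac F := forall e, 0 < e -> exists2 d, 0 < d &
  forall s, all (fun p => p.1 <= p.2) s -> pairwise itv_apart s ->
    total_length s < d -> increments F s <= e.

Lemma global_ac_clamp a b F : a <= b -> list_ac a b F ->
  global_ac (F \o clamp a b).
Proof.
move=> ab acF e /acF[d d0 dP]; exists d => // s /allP s12 sep sd.
pose s' := [seq (clamp a b p.1, clamp a b p.2) | p <- s].
have := dP s'; rewrite /increments/total_length !big_map/=; apply.
- rewrite /apart_itvs all_map pairwise_map; apply/andP; split.
    apply/allP => p ps /=; rewrite clamp_ge clamp_le// andbT/= clamp_homo//.
    exact: s12.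
  apply: sub_pairwise sep => p q /orP[h|h]; rewrite /itv_apart/=.
    by rewrite clamp_homo.
  by rewrite orbC clamp_homo.
- apply: le_lt_trans sd; rewrite big_seq /total_length [leRHS]big_seq.
  by apply: ler_sum => p ps; exact/clampB/s12.
Qed.

Lemma global_ac_right_continuous F : global_ac F -> right_continuous F.
Proof.
move=> acF x; apply: cvg_within_filter; apply/cvgrPdist_le => e /acF[d d0 dP].
near=> y.
have : `|x - y| < d by near: y; exact: nbhsx_ballx.
have [xy|/ltW yx] := leP x y => [|] h.
  have := dP [:: (x, y)]; rewrite /= /total_length /increments !big_seq1/= andbT distrC.
  by apply => //; rewrite -(ger0_norm (_ : 0 <= y - x)) ?subr_ge0// distrC.
have := dP [:: (y, x)]; rewrite /= /total_length /increments !big_seq1/= andbT.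
by apply => //; rewrite -(ger0_norm (_ : 0 <= x - y)) ?subr_ge0.
Unshelve. all: by end_near. Qed.

End interval_lists.

(** * Lebesgue densities of Stieltjes measures, and increments bounded by the integral of the
    derivative *)

Section stieltjes.
Variable R : realType.
Implicit Types (F : cumulative R R) (p : R * R) (s : seq (R * R)).
Local Notation mu := (@lebesgue_measure R).
Local Notation LS := lebesgue_stieltjes_measure.

Lemma lebesgue_stieltjes_itv F x y : x <= y -> LS F `]x, y] = (F y - F x)%:E.
Proof.
move=> xy; rewrite /LS /measure_extension measurable_mu_extE/=; last exact: is_ocitv.
by rewrite wlength_itv_bnd.
Qed.

(** The list depends on [U] only. With the identity it computes the Lebesgue measure of [U], with
    [F] the Stieltjes mass, so absolute continuity of [F] compares the two. *)
Lemma finite_union_itvs (U : set (SetRing.type (ocitv_type R))) : measurable U ->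
  exists s, [/\ all (fun p => p.1 <= p.2) s, pairwise (@itv_apart R) s &
    forall F, LS F U = (\sum_(p <- s) (F p.2 - F p.1))%:E].
Proof.
move=> mU; have [->|/set0P U0] := eqVneq U set0.
  by exists [::]; split => // F; rewrite big_nil; exact: measure0.
have /choice[e eP] (X : set R) : exists p, SetRing.decomp U X -> p.1 < p.2 /\ X = `]p.1, p.2]%classic.
  have [DX|] := pselect (SetRing.decomp U X); last by exists (0, 0).
  have mX : ocitv X by apply: (SetRing.decomp_measurable mU); exact/mem_set.
  have [X0|[p p12 XE]] := (ocitvP X).1 mX; last by exists p.
  by have := SetRing.all_decomp_neq0 U0 DX; rewrite X0 => -[].
have finD := SetRing.decomp_finite_set U.
exists [seq e X | X <- finmap.enum_fset (fset_set (SetRing.decomp U))]; split.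
- rewrite all_map; apply/allP => X; rewrite in_fset_set// inE => /eP[h _].
  exact/ltW.
- rewrite pairwise_map.
  have dsP X : X \in finmap.enum_fset (fset_set (SetRing.decomp U)) -> SetRing.decomp U X.
    by rewrite in_fset_set// inE.
  have := finmap.fset_uniq (fset_set (SetRing.decomp U)).
  elim: (finmap.enum_fset _) dsP => // X ds ih dsP /= /andP[Xds uds].
  apply/andP; split; last by apply: ih => // Y Yds; apply: dsP; rewrite inE Yds orbT.
  apply/allP => Y Yds.
  have DX : SetRing.decomp U X by apply: dsP; rewrite inE eqxx.
  have DY : SetRing.decomp U Y by apply: dsP; rewrite inE Yds orbT.
  have [hX XE] := eP _ DX; have [hY YE] := eP _ DY.
  rewrite /= /itv_apart; apply/negPn/negP; rewrite negb_or -!ltNge => /andP[h1 h2].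
  suff XY : X = Y by rewrite XY Yds in Xds.
  apply: (SetRing.decomp_triv DX DY).
  (* If two cells are not apart, the smaller right endpoint lies in both half-open intervals, and
     disjointness of the decomposition makes the cells equal. *)
  pose m := Num.min (e X).2 (e Y).2.
  have mX : `](e X).1, (e X).2]%classic m.
    by rewrite /= in_itv/= lt_min hX h2 ge_min lexx.
  have mY : `](e Y).1, (e Y).2]%classic m.
    by rewrite /= in_itv/= lt_min h1 hY ge_min lexx orbT.
  by rewrite -XE in mX; rewrite -YE in mY; exists m.
- move=> F; rewrite -[in LHS](SetRing.cover_decomp U) measure_fin_bigcup//; last 2 first.
  + exact: SetRing.decomp_triv.
  + move=> X DX; apply: sub_sigma_algebra; apply: (SetRing.decomp_measurable mU); exact/mem_set.
  rewrite fsbig_finite//= big_map -sumEFin big_seq [RHS]big_seq.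
  apply: eq_bigr => X; rewrite in_fset_set// inE => /eP[h1 h2].
  by rewrite [in LHS]h2 lebesgue_stieltjes_itv// ltW.
Qed.

(** A null set is covered by countably many half-open intervals of total length below [d]. Each
    finite union of them has Stieltjes mass at most [e], and continuity from below carries the bound
    to the whole cover. *)
Lemma global_ac_dominates F : global_ac F -> LS F `<< mu.
Proof.
move=> acF; apply/null_content_dominatesP => A mA muA0.
apply/eqP; rewrite eq_le measure_ge0 andbT; apply/lee_addgt0Pr => e e0.
rewrite add0e; have [d d0 dP] := acF _ e0.
have : (mu A < d%:E)%E by rewrite muA0 lte_fin.
move=> /ereal_inf_lt[_ [I [mI AI] <-] Id].
have mI' k : measurable (I k : set (measurableTypeR R)) by apply: sub_sigma_algebra; exact: mI.
apply: (@le_trans _ _ (LS F (\bigcup_k I k))).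
  by apply: le_measure; rewrite ?inE//; exact: bigcup_measurable.
have H : (LS F \o (fun n => \bigcup_(k < n) I k)) n @[n --> \oo] --> LS F (\bigcup_k I k).
  rewrite (_ : \bigcup_k I k = \bigcup_n \bigcup_(k < n) I k); last first.
    apply/seteqP; split=> [x [k _ Ikx]|x [n _ [k /= kn Ikx]]]; last by exists k.
    by exists k.+1 => //; exists k => //=.
  apply: nondecreasing_cvg_mu.
  - by move=> n; exact: bigcup_measurable.
  - by apply: bigcup_measurable => n _; exact: bigcup_measurable.
  - move=> m n mn; apply/subsetPset => x [k /= km Ikx]; exists k => //=.
    exact: leq_trans mn.
rewrite -(cvg_lim _ H)//; apply: lime_le; first by apply/cvg_ex; eexists; exact: H.
near=> n; rewrite /=.
have [|s [s12 sep sE]] := @finite_union_itvs (\bigcup_(k < n) I k).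
  apply: fin_bigcup_measurable => [|k _]; first exact: finite_II.
  by apply: SetRing.measurable_subring; exact: mI.
rewrite sE lee_fin (le_trans _ (dP s s12 sep _))//.
  by apply: ler_sum => p _; exact: ler_norm.
rewrite -lte_fin -[X in (X < _)%E](sE idfun); apply: le_lt_trans Id.
apply: (@le_trans _ _ (mu (\bigcup_k I k))).
  apply: le_measure; rewrite ?inE.
  - exact: bigcup_measurable.
  - exact: bigcup_measurable.
  - by move=> x [k _ Ikx]; exists k.
apply: le_trans (measure_sigma_subadditive _ mI' _ (@subset_refl _ _)) _ => //.
  exact: bigcup_measurable.
apply: lee_nneseries => // k _.
by rewrite /= /lebesgue_measure /LS /measure_extension measurable_mu_extE.
Unshelve. all: by end_near. Qed.

Lemma nondecreasing_density (a b : R) (F : R -> R) : a < b ->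
  (forall x y, a <= x -> x <= y -> y <= b -> F x <= F y) -> list_ac a b F ->
  exists g : R -> R, mu.-integrable setT (EFin \o g) /\
    forall x, a <= x <= b -> F x - F a = \int[mu]_(t in `]a, x]) g t.
Proof.
move=> ab ndF acF; pose Fc := F \o clamp a b.
have acFc : global_ac Fc := global_ac_clamp (ltW ab) acF.
have ndFc : {homo Fc : x y / x <= y}.
  by move=> x y xy; apply: ndF; rewrite ?clamp_ge ?clamp_le ?clamp_homo// ltW.
pose C : cumulative R R := HB.pack Fc
  (isCumulative.Build R _ R Fc ndFc (global_ac_right_continuous acFc)).
have CE x : a <= x <= b -> C x = F x by move=> xab; rewrite /C /= /Fc /= clamp_id.
have mab : measurable (`]a, b]%classic : set (measurableTypeR R)) by [].
have fin : (LS C `]a, b]%classic < +oo)%E by rewrite lebesgue_stieltjes_itv ?ltry// ltW.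
(* Restriction to []a, b]] leaves the finite mass [F b - F a] and does not affect the intervals []a,
   x]] with [x <= b]. *)
pose nu : {finite_measure set (measurableTypeR R) -> \bar R} := mfrestr mab fin.
have numu : nu `<< mu.
  apply/null_content_dominatesP => A mA muA0.
  have /null_content_dominatesP/(_ A mA muA0) LA0 := @global_ac_dominates C acFc.
  apply/eqP; rewrite eq_le measure_ge0 andbT /nu /= /mfrestr /mrestr.
  by rewrite -LA0; apply: le_measure; rewrite ?inE//; exact: measurableI.
have [g [g0 gfin gint gE]] := radon_nikodym_sigma_finite numu.
have fgE : EFin \o (fine \o g) = g by apply/funext => x /=; rewrite fineK.
exists (fine \o g); split => [|x /andP[ax xb]]; first by rewrite fgE.
rewrite /Rintegral -/(EFin \o (fine \o g)) fgE -gE//.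
rewrite /nu /= /mfrestr /mrestr setIidl; last first.
  by move=> t /=; rewrite !in_itv/= => /andP[-> /le_trans]; apply.
by rewrite (lebesgue_stieltjes_itv C ax) !CE ?lexx ?ax ?xb ?(ltW ab).
Qed.

Lemma list_ac_density (a b : R) (f : R -> R) : a < b -> list_ac a b f ->
  exists g : R -> R, mu.-integrable setT (EFin \o g) /\
    forall x, a <= x <= b -> f x - f a = \int[mu]_(t in `]a, x]) g t.
Proof.
move=> ab acf; pose G x := fine (total_variation a x f).
have acG : list_ac a b G by exact: list_ac_variation.
have ndG x y : a <= x -> x <= y -> y <= b -> G x <= G y.
  move=> ax xy yb; rewrite -subr_ge0.
  have [-> _] := fine_total_variationB ax xy yb acf.
  by rewrite fine_ge0// total_variation_ge0.
have ndH x y : a <= x -> x <= y -> y <= b -> G x - f x <= G y - f y.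
  move=> ax xy yb; rewrite -subr_ge0.
  have [GE fin] := fine_total_variationB ax xy yb acf.
  have -> : G y - f y - (G x - f x) = (G y - G x) - (f y - f x) by ring.
  rewrite subr_ge0 GE (le_trans (ler_norm _))// -lee_fin fineK//.
  exact: total_variation_ge.
have [g1 [ig1 g1E]] := nondecreasing_density ab ndG acG.
have [g2 [ig2 g2E]] := nondecreasing_density ab ndH (list_acB acG acf).
exists (fun x => g1 x - g2 x); split=> [|x xab].
  by have := integrableB measurableT ig1 ig2.
rewrite RintegralB//; [|exact: integrableS ig1|exact: integrableS ig2].
by rewrite -g1E// -g2E//; ring.
Qed.

Lemma list_ac_increment (a b : R) (f : R -> R) : a < b -> list_ac a b f ->
  measurable_fun setT (derive1 f) ->
  (`|f b - f a|%:E <= \int[mu]_(x in `]a, b]) `|derive1 f x|%:E)%E.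
Proof.
move=> ab acf mf'; have [g [ig gE]] := list_ac_density ab acf.
have igb : mu.-integrable `]a, b] (EFin \o g) by exact: integrableS ig.
rewrite gE ?lexx ?(ltW ab)// EFin_normr_Rintegral//.
apply: le_trans (le_abse_integral _ _ (measurable_int _ igb)) _ => //.
have mag : measurable_fun [set: R] (abse \o (EFin \o g) : R -> \bar R).
  by apply: measurableT_comp => //; exact: measurable_int ig.
have maf : measurable_fun [set: R] (EFin \o (fun x => `|derive1 f x|) : R -> \bar R).
  by apply/measurable_EFinP; exact: measurableT_comp.
(* The endpoint [b] is dropped: a derivative looks at both sides of a point, and [f] is known to be
   a primitive of [g] only within [[a, b]]. *)
rewrite -[leLHS]integral_itv_bndo_bndc; last exact: measurable_funTS mag.
rewrite -[leRHS]integral_itv_bndo_bndc; last exact: measurable_funTS maf.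
apply: ae_ge0_le_integral => //; [exact: measurable_funTS mag|exact: measurable_funTS maf|].
have lg : locally_integrable [set: R] g.
  by have := integrable_locally measurableT ig; rewrite patch_setT.
have igy y : mu.-integrable [set` Interval (BRight a) (BRight y)] (EFin \o g).
  by exact: integrableS ig.
have := @FTC1 R g (BRight a) igy lg.
apply: filterS; first exact: (ae_filter_ringOfSetsType mu).
move=> x + /=; rewrite in_itv/= => + /andP[ax xb] => /(_ ax)[dg g'].
have nf : {near x, (fun y => (\int[mu]_(t in `]a, y]) g t) + f a) =1 f}.
  near=> y; rewrite -gE ?subrK//; apply/andP; split; apply/ltW; near: y.
    exact: lt_nbhsr.
  exact: lt_nbhsl.
suff -> : derive1 f x = g x by [].
rewrite -g' !derive1E -(@near_eq_derive R _ _ _ f x 1 nf) deriveD//.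
by rewrite derive_cst addr0.
Unshelve. all: by end_near. Qed.

End stieltjes.

Lemma loc_ac_increment (R : realType) (a b : R) (f : R -> R) : a <= b ->
  loc_abs_continuous f -> measurable_fun setT (derive1 f) ->
  (`|f b - f a|%:E <=
    \int[@lebesgue_measure R]_(x in `]a, b]) `|derive1 f x|%:E)%E.
Proof.
rewrite le_eqVlt => /predU1P[->|ab] lacf mf.
  by rewrite subrr normr0 integral_ge0// => x _; rewrite lee_fin.
by apply: list_ac_increment => //; exact/abs_continuous_list/lacf.
Qed.

(** * Dilations, power integrals and the Gamma function *)

Section affine.
Variable R : realType.
Local Notation mu := (@lebesgue_measure R).
Implicit Types (c a : R) (g : R -> \bar R) (D : set R).
Local Open Scope ereal_scope.

Lemma measurable_affine c a : measurable_fun setT (fun x : R => (c * x + a)%R).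
Proof. by apply: measurable_funD => //; exact: measurable_funM. Qed.

(** The pushforward of [mu] under the affine map, scaled by [c], has the right value on half-open
    intervals, and these determine Lebesgue measure. *)
Lemma lebesgue_measure_affine c a A : (0 < c)%R -> measurable A ->
  mu A = c%:E * mu ((fun x : R => (c * x + a)%R) @^-1` A).
Proof.
move=> c0 mA.
pose phi : measurableTypeR R -> measurableTypeR R := fun x : R => (c * x + a)%R.
have mphi : measurable_fun setT phi by exact: measurable_affine.
pose phi_pack : {mfun _ >-> _} := HB.pack phi (isMeasurableFun.Build _ _ _ _ phi mphi).
pose nu : {measure set (measurableTypeR R) -> \bar R} :=
  mscale (NngNum (ltW c0)) (pushforward mu phi_pack).
suff -> : mu A = nu mphi A by [].
apply: lebesgue_measure_unique => // _ [[l r]] _ <-.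
rewrite /nu /= /mscale /= /pushforward /=.
have -> : phi @^-1` `]l, r] = `]((l - a) / c)%R, ((r - a) / c)%R]%classic.
  apply/seteqP; split => x /=; rewrite !in_itv/= /phi ltr_pdivrMr// ler_pdivlMr//;
  by rewrite ltrBlDr lerBrDr mulrC.
rewrite !lebesgue_measure_itv/= !lte_fin ltr_pM2r ?invr_gt0// ltrD2r.
case: ifPn => _; last by rewrite mule0.
by rewrite -!EFinB -EFinM -mulrBl mulrCA divff ?gt_eqF// mulr1 opprB addrA subrK.
Qed.

Lemma ge0_integral_affine c a g : (0 < c)%R -> measurable_fun setT g ->
  (forall x, 0 <= g x) ->
  \int[mu]_x g x = c%:E * \int[mu]_x g (c * x + a)%R.
Proof.
move=> c0 mg g0.
pose phi : measurableTypeR R -> measurableTypeR R := fun x : R => (c * x + a)%R.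
have mphi : measurable_fun setT phi by exact: measurable_affine.
pose phi_pack : {mfun _ >-> _} := HB.pack phi (isMeasurableFun.Build _ _ _ _ phi mphi).
have := ge0_integral_pushforward mphi mu measurableT mg (fun y _ => g0 y).
rewrite preimage_setT => <-.
rewrite -(ge0_integral_mscale (pushforward mu phi_pack) measurableT (NngNum (ltW c0)) mg (fun x _ => g0 x)).
apply: eq_measure_integral => A mA _; rewrite /mscale/=.
exact: lebesgue_measure_affine.
Qed.

Lemma integral_affine c a g : (0 < c)%R -> mu.-integrable setT g ->
  \int[mu]_x g x = c%:E * \int[mu]_x g (c * x + a)%R /\
  mu.-integrable setT (fun x => g (c * x + a)%R).
Proof.
move=> c0 ig; have mg := measurable_int _ ig.
have mga : measurable_fun setT (fun x => g (c * x + a)%R).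
  by apply: (measurableT_comp mg); exact: measurable_affine.
have iga : mu.-integrable setT (fun x => g (c * x + a)%R).
  apply/integrableP; split => //.
  have /integrableP[_] := ig.
  rewrite (ge0_integral_affine a c0); [|exact: measurableT_comp|by []].
  have cE0 : 0 < c%:E by rewrite lte_fin.
  by move=> H; rewrite -(lte_pmul2l _ cE0)// gt0_muley.
split=> //; rewrite integralE [X in _ = _ * X]integralE.
rewrite (ge0_integral_affine a c0 (measurable_funepos mg))//.
rewrite (ge0_integral_affine a c0 (measurable_funeneg mg))//.
have pE x : (fun y => g (c * y + a)%R)^\+ x = g^\+ (c * x + a)%R.
  by rewrite !funeposE.
have nE x : (fun y => g (c * y + a)%R)^\- x = g^\- (c * x + a)%R.
  by rewrite !funenegE.
have := integrable_pos_fin_num measurableT iga.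
under eq_integral do rewrite pE.
move=> fin.
under [X in _ = _ * (_ - X)]eq_integral do rewrite nE.
by rewrite [RHS]muleBr// fin_num_adde_defr.
Qed.

(** Moving the domain into the integrand lets it depend on the other variable when Tonelli is
    applied. *)
Lemma integral_indicM D (h : R -> R) :
  \int[mu]_(x in D) (h x)%:E = \int[mu]_x (h x * \1_D x)%:E.
Proof.
rewrite integral_mkcond; apply: eq_integral => x _.
by rewrite patchE indicE; case: ifPn => _; rewrite ?mulr1 ?mulr0.
Qed.
End affine.

(** * Integrals of powers and of the exponential *)

Section powers.
Variable R : realType.
Local Notation mu := (@lebesgue_measure R).
Implicit Types (s h k u x : R).

Lemma is_derive_powR_div s x : s != 0 -> 0 < x ->
  is_derive x (1 : R) (fun t => t `^ s / s) (x `^ (s - 1)).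
Proof.
move=> s0 x0; have D := is_derive1_powR s x0.
have -> : (fun t => t `^ s / s) = s^-1 \*: (@powR R ^~ s).
  by apply/funext => t; rewrite /= mulrC.
by apply: is_derive_eq; rewrite /GRing.scale/= mulrA mulVf// mul1r.
Qed.

Lemma continuous_powRl s x : 0 < x -> {for x, continuous (@powR R ^~ s)}.
Proof.
move=> x0; apply/differentiable_continuous/derivable1_diffP.
by apply: derivable_powR; rewrite in_itv/= x0.
Qed.

Lemma continuous_powR_within s (A : set R) : A `<=` `]0, +oo[ ->
  {within A, continuous (@powR R ^~ s)}.
Proof.
move=> A0; apply: continuous_in_subspaceT => x /set_mem /A0.
by rewrite /= in_itv/= andbT; exact: continuous_powRl.
Qed.

Lemma powRN_cvgy k : 0 < k -> t `^ (- k) @[t --> +oo] --> (0 : R).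
Proof.
move=> k0; apply: (@cvg_trans _ ((expR (- (k * ln t))) @[t --> +oo])).
  apply: near_eq_cvg; near=> t; rewrite /powR gt_eqF ?mulNr//.
apply: (@cvg_comp _ _ _ (fun t => k * ln t) (fun t : R => expR (- t)) _ (pinfty_nbhs R)); last exact: cvgr_expR.
apply: gt0_cvgMry => //; apply/cvgryPge => A; near=> t.
by rewrite -(expRK A) ler_ln ?posrE ?expR_gt0//.
Unshelve. all: by end_near. Qed.

Lemma integral_powR_tail k h : 0 < k -> 0 < h ->
  (\int[mu]_(t in `]h, +oo[) (t `^ (- (1 + k)))%:E = (h `^ (- k) / k)%:E)%E.
Proof.
move=> k0 h0; have k1 : - k != 0 by rewrite oppr_eq0 gt_eqF.
rewrite integral_itv_obnd_cbnd; last first.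
  by apply/measurable_EFinP/measurable_funTS; exact: measurable_powR.
rewrite (@ge0_continuous_FTC2y _ _ (fun t => t `^ (- k) / (- k)) _ 0).
- by rewrite sub0e -EFinN invrN mulrN opprK.
- by move=> x _; exact: powR_ge0.
- apply: continuous_powR_within => x /=; rewrite !in_itv/= !andbT.
  exact: lt_le_trans.
- by rewrite -[X in _ --> X](mul0r (- k)^-1); apply: cvgMl; exact: powRN_cvgy.
- move=> x hx; have x0 := lt_trans h0 hx.
  by have [] := is_derive_powR_div k1 x0.
- by apply: cvg_at_right_filter; apply: cvgMl; exact: continuous_powRl.
- move=> x; rewrite in_itv/= andbT => hx; have x0 := lt_trans h0 hx.
  have [_] := is_derive_powR_div k1 x0.
  by rewrite derive1E => ->; rewrite opprD addrC.
Qed.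

Lemma integral_powR_segment s u h : s != 0 -> 0 < u -> u < h ->
  (\int[mu]_(t in `[u, h]) (t `^ (s - 1))%:E = (h `^ s / s - u `^ s / s)%:E)%E.
Proof.
move=> s0 u0 uh; have h0 := lt_trans u0 uh.
rewrite (@continuous_FTC2 _ _ (fun t => t `^ s / s))//.
- apply: continuous_powR_within => x /=; rewrite !in_itv/= andbT => /andP[ux _].
  exact: lt_le_trans ux.
- split.
  + move=> x; rewrite in_itv/= => /andP[ux _].
    by have [] := is_derive_powR_div s0 (lt_trans u0 ux).
  + by apply: cvg_at_right_filter; apply: cvgMl; exact: continuous_powRl.
  + by apply: cvg_at_left_filter; apply: cvgMl; exact: continuous_powRl.
- move=> x; rewrite in_itv/= => /andP[ux _].
  have [_] := is_derive_powR_div s0 (lt_trans u0 ux).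
  by rewrite derive1E => ->.
Qed.

(** The integrand may be singular at 0, so []0, h]] is exhausted by the segments [[h / (n + 2), h]]
    and monotone convergence is used. *)
Lemma integral_powR_head s h : 0 < s -> 0 < h ->
  (\int[mu]_(t in `]0%R, h]) (t `^ (s - 1))%:E = (h `^ s / s)%:E)%E.
Proof.
(* With [n.+2] the left endpoint is smaller than [h] already for [n = 0]. *)
move=> s0 h0; pose G n : set R := `[h / n.+2%:R, h]%classic.
have UG : `]0, h]%classic = \bigcup_n G n.
  apply/seteqP; split => [x /=|x [n _] /=]; rewrite !in_itv/=; last first.
    by rewrite /G /= in_itv/= => /andP[hx ->]; rewrite (lt_le_trans _ hx)// divr_gt0.
  move=> /andP[x0 xh]; exists (Num.truncn (h / x)) => //=.
  rewrite /G /= in_itv/= xh andbT ler_pdivrMr// mulrC -ler_pdivrMr//.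
  by rewrite (le_trans (ltW (truncnS_gt _)))// ler_nat leqnSn.
rewrite UG.
have H := @ge0_nondecreasing_set_cvg_integral _ (measurableTypeR R) R G (EFin \o (@powR R ^~ (s - 1))) mu.
have {}H : (\int[mu]_(t in G n) (t `^ (s - 1))%:E @[n --> \oo] -->
    \int[mu]_(t in \bigcup_n G n) (t `^ (s - 1))%:E)%E.
  apply: H => //.
  - move=> m n mn; apply/subsetPset => x; rewrite /G /= !in_itv/= => /andP[+ ->].
    rewrite andbT; apply: le_trans.
    by rewrite ler_pM2l// lef_pV2 ?posrE// ler_nat !ltnS.
  - by move=> i; exact: measurable_itv.
  - by move=> i; apply/measurable_EFinP/measurable_funTS; exact: measurable_powR.
  - by move=> i x _; rewrite lee_fin powR_ge0.
rewrite -(cvg_lim _ H)//; apply/cvg_lim => //.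
have -> : (fun n => \int[mu]_(t in G n) (t `^ (s - 1))%:E)%E =
    (fun n => (h `^ s / s - (h / n.+2%:R) `^ s / s)%:E).
  apply/funext => n; rewrite integral_powR_segment// ?gt_eqF// ?divr_gt0//.
  by rewrite ltr_pdivrMr// ltr_pMr// ltr1n.
apply/cvg_EFin; first by apply: nearW.
rewrite -[X in _ --> X]subr0 -[X in _ - X](mul0r s^-1).
apply: cvgB; first exact: cvg_cst.
apply: cvgMl.
have /cvg_at_rightP/(_ (fun n => h / n.+2%:R)) := powR_cvg0 s0; apply; split.
  by move=> n; rewrite divr_gt0.
rewrite -[X in _ --> X](mulr0 h); apply: cvgMr.
by have := @cvg_harmonic R; rewrite -cvg_shiftS.
Qed.

Lemma continuous_expRN x : {for x, continuous (fun t : R => expR (- t))}.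
Proof. by apply: continuous_comp; [exact: opp_continuous|exact: continuous_expR]. Qed.

Lemma integral_expRN u : (\int[mu]_(t in `[u, +oo[) (expR (- t))%:E = (expR (- u))%:E)%E.
Proof.
rewrite (@ge0_continuous_FTC2y _ _ (fun t => - expR (- t)) _ 0).
- by rewrite sub0e -EFinN opprK.
- by move=> t _; exact: expR_ge0.
- by apply: continuous_subspaceT => x; exact: continuous_expRN.
- by rewrite -oppr0; apply: cvgN; exact: cvgr_expR.
- by move=> x _; exact: ex_derive.
- by apply: cvg_at_right_filter; apply: cvgN; exact: continuous_expRN.
- move=> x _; rewrite derive1_comp// derive1N// derive1_id mulN1r derive1_comp// derive1E.
  have /funeqP -> := @derive_expR R.
  by rewrite derive1N// derive1_id mulrN1 opprK.
Qed.
End powers.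

(** A zero integral would make [g] vanish almost everywhere on [D], whereas []0, 1]] has measure 1.
    This gives the positivity behind both Gamma and [varkappa_sum]. *)
Lemma integral_gt0_itv (R : realType) (D : set R) (g : R -> R) :
  measurable D -> `]0, 1] `<=` D -> measurable_fun D g -> (forall t, 0 <= g t) ->
  (forall t, 0 < t <= 1 -> 0 < g t) ->
  (0 < \int[@lebesgue_measure R]_(t in D) (g t)%:E)%E.
Proof.
move=> mD D01 mg g0 gpos.
rewrite lt0e integral_ge0 ?andbT; last by move=> t _; rewrite lee_fin.
apply/eqP => I0.
have mG : measurable_fun D (EFin \o g) by exact/measurable_EFinP.
have H : (\int[@lebesgue_measure R]_(t in D) `|(g t)%:E| = 0)%E.
  by rewrite -[RHS]I0; apply: eq_integral => t _; rewrite gee0_abs// lee_fin.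
have : ae_eq (@lebesgue_measure R) D (EFin \o g) (cst 0%E).
  by apply/ae_eq_integral_abs.
move=> [N [mN N0 sub]].
have : (@lebesgue_measure R `]0%R, 1%R]%classic <= @lebesgue_measure R N)%E.
  apply: le_measure; rewrite ?inE// => t t01.
  apply: sub => /= /(_ (D01 _ t01)) [] gt0.
  by move: t01; rewrite /= in_itv/= => /gpos; rewrite gt0 ltxx.
by rewrite [X in (_ <= X)%E -> _](_ : _ = 0%E)// lebesgue_measure_itv/= lte_fin ltr01 -EFinB subr0 lee_fin ler10.
Qed.

(** * Finiteness, positivity and functional equation of Gamma *)

Section gamma.
Variable R : realType.
Local Notation mu := (@lebesgue_measure R).
Implicit Types (s : R).

Definition gamma_fun s (t : R) : R := t `^ (s - 1) * expR (- t).

Lemma gamma_fun_ge0 s t : 0 <= gamma_fun s t.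
Proof. by rewrite mulr_ge0 ?powR_ge0 ?expR_ge0. Qed.

Lemma measurable_gamma_fun s : measurable_fun setT (gamma_fun s).
Proof.
apply: measurable_funM; first exact: measurable_powR.
by apply: measurableT_comp => //; exact: measurableT_comp.
Qed.

(* Tonelli on [0 < u <= t], with [t^s = \int_(0, t] s u^(s - 1) du], stands in for
   an improper integration by parts. *)
Lemma gamma_integral_recE s : 0 < s ->
  (\int[mu]_(t in `]0%R, +oo[) (gamma_fun (s + 1) t)%:E =
   s%:E * \int[mu]_(t in `]0%R, +oo[) (gamma_fun s t)%:E)%E.
Proof.
move=> s0.
pose F (z : R * R) : \bar R := (s * z.2 `^ (s - 1) * expR (- z.1) *
  (\1_(`]0, +oo[) z.2 * (z.2 <= z.1)%R%:R))%:E.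
have F0 z : (0 <= F z)%E.
  by rewrite lee_fin !mulr_ge0 ?powR_ge0 ?expR_ge0// ltW.
have mF : measurable_fun setT F.
  apply/measurable_EFinP; apply: measurable_funM; first apply: measurable_funM.
  - apply: measurable_funM => //.
    by apply: (measurableT_comp (measurable_powR _)); exact: measurable_snd.
  - apply: (measurableT_comp (@measurable_expR R)).
    by apply: measurableT_comp => //; exact: measurable_fst.
  - apply: measurable_funM.
      have mi : measurable_fun setT (\1_(`]0, +oo[%classic : set R) : R -> R).
        exact: measurable_indic.
      exact: (measurableT_comp mi measurable_snd).
    have mb : measurable_fun setT (fun b : bool => b%:R : R) by [].
    apply: (measurableT_comp mb).
    by apply: measurable_fun_ler; [exact: measurable_snd|exact: measurable_fst].
have := fubini_tonelli (m1 := mu) (m2 := mu) F mF F0.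
have -> : (\int[mu]_x \int[mu]_y F (x, y) = \int[mu]_(t in `]0%R, +oo[) (gamma_fun (s + 1) t)%:E)%E.
  rewrite (integral_indicM `]0, +oo[%classic); apply: eq_integral => t _.
  have [t0|t0] := leP t 0.
    rewrite indicE memNset ?mulr0/=; last by rewrite in_itv/= andbT ltNge t0.
    apply: integral0_eq => u _; rewrite /F/= indicE; case: (boolP (u \in _)) => [|_]; last by rewrite mul0r mulr0.
    rewrite inE/= in_itv/= andbT => u0.
    by rewrite leNgt (le_lt_trans t0 u0) !mulr0.
  rewrite indicE mem_set ?mulr1/=; last by rewrite in_itv/= andbT.
  have -> : (gamma_fun (s + 1) t)%:E = ((s * expR (- t))%:E * (t `^ s / s)%:E)%E.
    rewrite /gamma_fun addrK -EFinM; congr (_%:E).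
    by field; rewrite gt_eqF.
  rewrite -integral_powR_head// (integral_indicM `]0, t]%classic).
  rewrite -ge0_integralZl//; last 3 first.
  - apply/measurable_EFinP/measurable_funM; [exact: measurable_powR|exact: measurable_indic].
  - by move=> u _; rewrite lee_fin mulr_ge0 ?powR_ge0.
  - by rewrite lee_fin mulr_ge0 ?expR_ge0// ltW.
  apply: eq_integral => u _; rewrite /F/= -EFinM; congr (_%:E).
  have -> : \1_`]0, t] u = \1_(`]0, +oo[) u * (u <= t)%R%:R :> R.
    rewrite !indicE !mem_setE !in_itv/= andbT.
    by case: (0 < u); case: (u <= t); rewrite ?mulr0 ?mul0r ?mulr1.
  by ring.
have -> : (\int[mu]_y \int[mu]_x F (x, y) = s%:E * \int[mu]_(t in `]0%R, +oo[) (gamma_fun s t)%:E)%E.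
  rewrite (integral_indicM `]0, +oo[%classic) -ge0_integralZl//; last 3 first.
  - apply/measurable_EFinP/measurable_funM; [exact: measurable_gamma_fun|exact: measurable_indic].
  - by move=> u _; rewrite lee_fin mulr_ge0 ?gamma_fun_ge0.
  - by rewrite lee_fin ltW.
  apply: eq_integral => u _.
  transitivity ((s * u `^ (s - 1) * \1_(`]0, +oo[) u)%:E * \int[mu]_(t in `[u, +oo[) (expR (- t))%:E)%E.
    rewrite (integral_indicM `[u, +oo[%classic) -ge0_integralZl//; last 2 first.
    - apply/measurable_EFinP/measurable_funM; last exact: measurable_indic.
      by apply: measurableT_comp => //; exact: measurableT_comp.
    - by rewrite lee_fin !mulr_ge0 ?powR_ge0// ltW.
    apply: eq_integral => t _; rewrite /F/= -EFinM; congr (_%:E).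
    have -> : \1_`[u, +oo[ t = (u <= t)%R%:R :> R.
      by rewrite indicE mem_setE in_itv/= andbT.
    by ring.
  by rewrite integral_expRN -!EFinM /gamma_fun; congr (_%:E); ring.
by move=> ->.
Qed.

(** The comparison functions are [t^(s - 1)] on []0, 1]] and [exp (- t)] beyond 1, where [s <= 1]
    gives [t^(s - 1) <= 1]. The value [Gamma (2 - k)] is reached through [Gamma_rec]. *)
Lemma gamma_integral_fin s : 0 < s -> s <= 1 ->
  (\int[mu]_(t in `]0%R, +oo[) (gamma_fun s t)%:E)%E \is a fin_num.
Proof.
move=> s0 s1.
have mG := measurable_gamma_fun s.
rewrite ge0_fin_numE; last by apply: integral_ge0 => t _; rewrite lee_fin gamma_fun_ge0.
have -> : `]0, +oo[%classic = (`]0, 1] `|` `]1, +oo[)%classic :> set R.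
  by rewrite -itv_bndbnd_setU// bnd_simp.
rewrite ge0_integral_setU//=; last 3 first.
- by apply/measurable_EFinP; apply: measurable_funTS.
- by move=> t _; rewrite lee_fin gamma_fun_ge0.
- apply/disj_setPS => t [] /=; rewrite !in_itv/= => /andP[_ t1] /andP[t2 _].
  by move: t2; rewrite ltNge t1.
apply: lte_add_pinfty.
- apply: (@le_lt_trans _ _ (\int[mu]_(t in `]0%R, 1%R]) (t `^ (s - 1))%:E)%E); last first.
    by rewrite integral_powR_head// ltry.
  apply: ge0_le_integral => //.
  + by move=> t _; rewrite lee_fin gamma_fun_ge0.
  + by apply/measurable_EFinP; apply: measurable_funTS.
  + by apply/measurable_EFinP; apply: measurable_funTS; exact: measurable_powR.
  + move=> t /=; rewrite in_itv/= => /andP[t0 _]; rewrite lee_fin ler_piMr ?powR_ge0//.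
    by rewrite -expR0 ler_expR oppr_le0 ltW.
- apply: (@le_lt_trans _ _ (\int[mu]_(t in `]1%R, +oo[) (expR (- t))%:E)%E); last first.
    rewrite integral_itv_obnd_cbnd ?integral_expRN ?ltry//.
    apply/measurable_EFinP; apply: measurable_funTS; apply: measurableT_comp => //.
  apply: ge0_le_integral => //.
  + by move=> t _; rewrite lee_fin gamma_fun_ge0.
  + by apply/measurable_EFinP; apply: measurable_funTS.
  + by apply/measurable_EFinP; apply: measurable_funTS; apply: measurableT_comp.
  + move=> t /=; rewrite in_itv/= andbT => t1; rewrite lee_fin ler_piMl ?expR_ge0//.
    by rewrite -[leRHS](powRr0 t); apply: ler_powR; [exact: ltW|rewrite subr_le0].
Qed.

Lemma gamma_integral_gt0 s : 0 < s ->
  (0 < \int[mu]_(t in `]0%R, +oo[) (gamma_fun s t)%:E)%E.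
Proof.
move=> s0; apply: integral_gt0_itv => //.
- by move=> t /=; rewrite !in_itv/= => /andP[->].
- by apply: measurable_funTS; exact: measurable_gamma_fun.
- by move=> t; exact: gamma_fun_ge0.
- by move=> t /andP[t0 _]; rewrite mulr_gt0 ?powR_gt0 ?expR_gt0.
Qed.

Lemma Gamma_pos s : 0 < s -> Gamma s = Gamma_integral s.
Proof. by move=> s0; rewrite /Gamma s0 big_ord0 addr0 divr1. Qed.

Lemma Gamma_integral_gt0 s : 0 < s -> s <= 1 -> 0 < Gamma_integral s.
Proof.
move=> s0 s1; rewrite /Gamma_integral /Rintegral.
apply: fine_gt0; rewrite gamma_integral_gt0//=.
by rewrite -ge0_fin_numE ?gamma_integral_fin// ltW// gamma_integral_gt0.
Qed.

Lemma Gamma_rec s : 0 < s -> s <= 1 -> Gamma (s + 1) = s * Gamma s.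
Proof.
move=> s0 s1; rewrite !Gamma_pos ?addr_gt0//.
rewrite /Gamma_integral /Rintegral gamma_integral_recE//.
by rewrite fineM// gamma_integral_fin.
Qed.

Lemma Gamma_gt0 s : 0 < s -> s <= 1 -> 0 < Gamma s.
Proof. by move=> s0 s1; rewrite Gamma_pos// Gamma_integral_gt0. Qed.

(** The integer part of [s] is 0, so the continuation takes a single step, [m = 1]. *)
Lemma Gamma_neg s : 0 < s -> s < 1 -> Gamma (- s) = - (Gamma (1 - s) / s).
Proof.
move=> s0 s1; rewrite (@Gamma_pos (1 - s)) ?subr_gt0// /Gamma oppr_gt0 ltNge (ltW s0)/=.
rewrite opprK (_ : Num.truncn s = 0%N); last first.
  apply/eqP; rewrite -leqn0 -ltnS -(ltr_nat R).
  by have /andP[/le_lt_trans-> ] := truncn_itv (ltW s0).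
by rewrite big_ord1 addr0 addrC invrN mulrN.
Qed.

End gamma.

(** * The Marchaud derivative in [L_1] *)

Section shifts.
Variable R : realType.
Local Notation mu := (@lebesgue_measure R).
Implicit Types (f p : R -> R) (k h t x : R).

Definition L1n f : \bar R := (\int[mu]_x `|f x|%:E)%E.

Lemma L1n_ge0 f : (0 <= L1n f)%E.
Proof. by apply: integral_ge0 => x _; rewrite lee_fin. Qed.

Lemma ge0_integral_shift (g : R -> \bar R) (a : R) : measurable_fun setT g ->
  (forall x, 0 <= g x)%E -> (\int[mu]_x g (x + a)%R = \int[mu]_x g x)%E.
Proof.
move=> mg g0; rewrite [RHS](ge0_integral_affine a ltr01 mg g0) mul1e.
by apply: eq_integral => x _; rewrite mul1r.
Qed.

Lemma measurable_shift f a : measurable_fun setT f ->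
  measurable_fun setT (fun x : R => f (x + a)).
Proof. by move=> mf; apply: (measurableT_comp mf); exact: measurable_funD. Qed.

Lemma measurable_add2 f : measurable_fun setT f ->
  measurable_fun setT (fun z : R * R => f (z.1 + z.2)).
Proof.
move=> mf; apply: (measurableT_comp mf).
by apply: measurable_funD; [exact: measurable_fst|exact: measurable_snd].
Qed.

Lemma measurable_bool2 (b : R * R -> bool) : measurable_fun setT b ->
  measurable_fun setT (fun z => (b z)%:R : R).
Proof.
move=> mb; have m : measurable_fun setT (fun b : bool => b%:R : R) by [].
exact: (measurableT_comp m).
Qed.

Lemma integral_norm_diff_le2 f t : measurable_fun setT f ->
  (\int[mu]_x `|f x - f (x + t)%R|%:E <= 2%:E * L1n f)%E.
Proof.
move=> mf; have mft := measurable_shift t mf.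
have mn : measurable_fun setT (fun x => `|f x|%:E : \bar R).
  by apply/measurable_EFinP; exact: measurableT_comp.
have mnt : measurable_fun setT (fun x => `|f (x + t)|%:E : \bar R).
  by apply/measurable_EFinP; exact: measurableT_comp.
have -> : (2%:E * L1n f = \int[mu]_x (`|f x|%:E + `|f (x + t)%R|%:E))%E.
  rewrite ge0_integralD//= (@ge0_integral_shift (fun x => `|f x|%:E))//.
  by rewrite mule_natl mule2n.
apply: ge0_le_integral => //.
- apply/measurable_EFinP; apply: measurableT_comp => //.
  exact: measurable_funB.
- exact: emeasurable_funD.
- by move=> x _; rewrite -EFinD lee_fin ler_normB.
Qed.

(** After bounding the increment by the integral of [|f'|] over []x, x + t]], integrate in [x]
    first: a point [u] is counted exactly for [x] in [[u - t, u[], a set of measure [t]. *)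
Lemma integral_norm_diff_le_derive f t : 0 <= t -> loc_abs_continuous f ->
  measurable_fun setT f -> measurable_fun setT (derive1 f) ->
  (\int[mu]_x `|f x - f (x + t)%R|%:E <= t%:E * L1n (derive1 f))%E.
Proof.
move=> t0 acf mf mf'.
pose F (z : R * R) : \bar R :=
  (`|derive1 f z.2| * ((z.1 < z.2)%R%:R * (z.2 <= z.1 + t)%R%:R))%:E.
have F0 z : (0 <= F z)%E by rewrite lee_fin !mulr_ge0.
have mF : measurable_fun setT F.
  apply/measurable_EFinP; apply: measurable_funM.
    apply: measurableT_comp => //.
    by apply: (measurableT_comp mf'); exact: measurable_snd.
  apply: measurable_funM; apply: measurable_bool2.
    by apply: measurable_fun_ltr; [exact: measurable_fst|exact: measurable_snd].
  apply: measurable_fun_ler; first exact: measurable_snd.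
  by apply: measurable_funD => //; exact: measurable_fst.
apply: (@le_trans _ _ (\int[mu]_x \int[mu]_u F (x, u))%E).
  apply: ge0_le_integral => //.
  - apply/measurable_EFinP; apply: measurableT_comp => //.
    by apply: measurable_funB => //; exact: measurable_shift.
  - by have := measurable_fun_fubini_tonelli_F (m2 := mu) F mF F0.
  - move=> x _; rewrite distrC.
    apply: le_trans (loc_ac_increment _ acf mf') _; first by rewrite lerDl.
    rewrite (integral_indicM `]x, (x + t)%R]%classic) le_eqVlt; apply/orP; left; apply/eqP.
    apply: eq_integral => u _; rewrite /F/= indicE mem_setE in_itv/=.
    by rewrite -mulnb natrM.
rewrite (fubini_tonelli (m1 := mu) (m2 := mu) F mF F0) /L1n.
rewrite -ge0_integralZl//; last by apply/measurable_EFinP; exact: measurableT_comp.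
rewrite le_eqVlt; apply/orP; left; apply/eqP.
apply: eq_integral => u _.
transitivity (\int[mu]_(x in `[(u - t)%R, u[%classic) (`|derive1 f u|%:E))%E.
  rewrite (integral_indicM `[(u - t)%R, u[%classic).
  apply: eq_integral => x _; rewrite /F/= indicE mem_setE in_itv/=.
  by rewrite lerBlDr andbC -mulnb natrM.
rewrite integral_cst//= lebesgue_measure_itv/= lte_fin.
case: ltP => [_|]; first by rewrite -EFinB opprB addrC subrK muleC.
rewrite lerBrDl gerDr => tle0; have -> : t = 0 by apply/le_anti; rewrite t0 tle0.
by rewrite mule0 mul0e.
Qed.

(** The domain []0, +oo[] is built in, so that dilations and Tonelli act on integrals over the whole
    line. *)
Definition marchaud_weight k t : R := \1_(`]0, +oo[%classic : set R) t / t `^ (1 + k).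

Lemma marchaud_weight_ge0 k t : 0 <= marchaud_weight k t.
Proof. by rewrite divr_ge0 ?powR_ge0. Qed.

Lemma marchaud_weight0 k t : t <= 0 -> marchaud_weight k t = 0.
Proof.
by move=> t0; rewrite /marchaud_weight indicE mem_setE in_itv/= andbT ltNge t0 mul0r.
Qed.

Lemma marchaud_weight_pos k t : 0 < t -> marchaud_weight k t = t `^ (- (1 + k)).
Proof.
by move=> t0; rewrite /marchaud_weight indicE mem_setE in_itv/= andbT t0 mul1r powRN.
Qed.

Lemma measurable_marchaud_weight k : measurable_fun setT (marchaud_weight k).
Proof.
have -> : marchaud_weight k = (fun t => \1_(`]0, +oo[%classic : set R) t * t `^ (- (1 + k))).
  by apply/funext => t; rewrite powRN.
by apply: measurable_funM; [exact: measurable_indic|exact: measurable_powR].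
Qed.

Lemma integral_weight (g : R -> R) k : (\int[mu]_(t in `]0%R, +oo[) (g t / t `^ (1 + k))%:E =
  \int[mu]_t (g t * marchaud_weight k t)%:E)%E.
Proof.
rewrite (integral_indicM `]0, +oo[%classic); apply: eq_integral => t _.
by rewrite /marchaud_weight; congr (_%:E); ring.
Qed.

(** The exponent is [- k] and not [- (1 + k)] because the factor [t] of the bound [t ||f'||], used
    for [t <= h], has been absorbed. *)
Definition near_weight k h t : R := t `^ (- k) * \1_(`]0, h]%classic : set R) t.
Definition far_weight k h t : R := t `^ (- (1 + k)) * \1_(`]h, +oo[%classic : set R) t.

Lemma near_weight_ge0 k h t : 0 <= near_weight k h t.
Proof. by rewrite mulr_ge0 ?powR_ge0. Qed.

Lemma far_weight_ge0 k h t : 0 <= far_weight k h t.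
Proof. by rewrite mulr_ge0 ?powR_ge0. Qed.

Lemma measurable_near_weight k h : measurable_fun setT (near_weight k h).
Proof. by apply: measurable_funM; [exact: measurable_powR|exact: measurable_indic]. Qed.

Lemma measurable_far_weight k h : measurable_fun setT (far_weight k h).
Proof. by apply: measurable_funM; [exact: measurable_powR|exact: measurable_indic]. Qed.

Lemma integral_near_weight k h : k < 1 -> 0 < h ->
  (\int[mu]_t (near_weight k h t)%:E = (h `^ (1 - k) / (1 - k))%:E)%E.
Proof.
move=> k1 h0; rewrite -integral_powR_head ?subr_gt0//.
rewrite (integral_indicM `]0, h]%classic); apply: eq_integral => t _.
by rewrite /near_weight addrC addKr.
Qed.

Lemma integral_far_weight k h : 0 < k -> 0 < h ->
  (\int[mu]_t (far_weight k h t)%:E = (h `^ (- k) / k)%:E)%E.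
Proof.
move=> k0 h0; rewrite -integral_powR_tail//.
by rewrite (integral_indicM `]h, +oo[%classic).
Qed.

(** The splitting at [t = h], for an abstract [S] bounded by [a] and by [t b]. It serves both for
    the [L_1] norm of a difference of [f] and for [1 - exp (- t)]. *)
Lemma weight_le_near_far k h (a b S : \bar R) t : 0 < h ->
  (0 <= a)%E -> (0 <= b)%E -> (0 <= S)%E ->
  (S <= a)%E -> ((0 <= t)%R -> S <= t%:E * b)%E ->
  ((marchaud_weight k t)%:E * S <= (near_weight k h t)%:E * b + (far_weight k h t)%:E * a)%E.
Proof.
move=> h0 a0 b0 S0 Sa Sb.
have [t0|t0] := leP t 0.
  by rewrite marchaud_weight0// mul0e adde_ge0// mule_ge0// lee_fin ?near_weight_ge0 ?far_weight_ge0.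
rewrite marchaud_weight_pos// /near_weight /far_weight !indicE !mem_setE !in_itv/= t0/= andbT.
have [th|th] := leP t h.
  rewrite !mulr1 mulr0 mul0e adde0.
  have -> : t `^ (- k) = t `^ (- (1 + k)) * t.
    have -> : - k = - (1 + k) + 1 by ring.
    by rewrite powRD ?powRr1 ?(ltW t0)// (gt_eqF t0) implybT.
  by rewrite EFinM -muleA lee_pmul2l// ?lte_fin ?powR_gt0// Sb// ltW.
by rewrite mulr0 mul0e add0e mulr1 lee_wpmul2l// lee_fin powR_ge0.
Qed.

Definition marchaud_kernel k f (z : R * R) : R :=
  (f z.1 - f (z.1 + z.2)) * marchaud_weight k z.2.

Lemma measurable_marchaud_kernel k f : measurable_fun setT f ->
  measurable_fun setT (marchaud_kernel k f).
Proof.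
move=> mf; apply: measurable_funM.
  apply: measurable_funB; last exact: measurable_add2.
  by apply: (measurableT_comp mf); exact: measurable_fst.
apply: (measurableT_comp (measurable_marchaud_weight k)); exact: measurable_snd.
Qed.

(** The absolute value is kept inside both integrals: for general [h] this yields the additive
    inequality, and for [h = 1] the integrability of the kernel on the product, which Fubini
    needs. *)
Lemma marchaud_kernel_bound k h f : 0 < k -> k < 1 -> 0 < h ->
  loc_abs_continuous f -> measurable_fun setT f -> measurable_fun setT (derive1 f) ->
  (\int[mu]_x \int[mu]_t `|marchaud_kernel k f (x, t)|%:E <=
   (2 * h `^ (- k) / k)%:E * L1n f +
   (h `^ (1 - k) / (1 - k))%:E * L1n (derive1 f))%E.
Proof.
move=> k0 k1 h0 acf mf mf'.
pose F (z : R * R) : \bar R := `|marchaud_kernel k f z|%:E.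
have F0 z : (0 <= F z)%E by rewrite lee_fin.
have mF : measurable_fun setT F.
  by apply/measurable_EFinP; apply: measurableT_comp => //; exact: measurable_marchaud_kernel.
rewrite (fubini_tonelli (m1 := mu) (m2 := mu) F mF F0).
pose a := (2%:E * L1n f)%E; pose b := L1n (derive1 f).
have a0 : (0 <= a)%E by rewrite mule_ge0// L1n_ge0.
have b0 : (0 <= b)%E by exact: L1n_ge0.
apply: (@le_trans _ _ (\int[mu]_t ((near_weight k h t)%:E * b + (far_weight k h t)%:E * a))%E).
  apply: ge0_le_integral => //.
  - by move=> t _; exact: integral_ge0.
  - by have := measurable_fun_fubini_tonelli_G (m1 := mu) F mF F0.
  - apply: emeasurable_funD; apply: emeasurable_funM => //; apply/measurable_EFinP.
      exact: measurable_near_weight.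
    exact: measurable_far_weight.
  - move=> t _.
    have S0 : (0 <= \int[mu]_x `|f x - f (x + t)%R|%:E)%E.
      by apply: integral_ge0 => x _; rewrite lee_fin.
    have H : ((marchaud_weight k t)%:E * \int[mu]_x `|f x - f (x + t)%R|%:E <=
        (near_weight k h t)%:E * b + (far_weight k h t)%:E * a)%E.
      apply: weight_le_near_far => //; first exact: integral_norm_diff_le2.
      by move=> t0; exact: integral_norm_diff_le_derive.
    apply: le_trans H; rewrite -ge0_integralZl//; last 2 first.
    + apply/measurable_EFinP; apply: measurableT_comp => //.
      by apply: measurable_funB => //; exact: measurable_shift.
    + by rewrite lee_fin marchaud_weight_ge0.
    rewrite le_eqVlt; apply/orP; left; apply/eqP; apply: eq_integral => x _.
    by rewrite /F/= /marchaud_kernel normrM (ger0_norm (marchaud_weight_ge0 _ _)) EFinM muleC.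
rewrite ge0_integralD//; last 4 first.
- by move=> t _; rewrite mule_ge0// lee_fin near_weight_ge0.
- apply: emeasurable_funM => //; apply/measurable_EFinP; exact: measurable_near_weight.
- by move=> t _; rewrite mule_ge0// lee_fin far_weight_ge0.
- apply: emeasurable_funM => //; apply/measurable_EFinP; exact: measurable_far_weight.
rewrite ge0_integralZr//; last 2 first.
- by apply/measurable_EFinP; exact: measurable_near_weight.
- by move=> t _; rewrite lee_fin near_weight_ge0.
rewrite ge0_integralZr//; last 2 first.
- by apply/measurable_EFinP; exact: measurable_far_weight.
- by move=> t _; rewrite lee_fin far_weight_ge0.
rewrite integral_near_weight// integral_far_weight// /a /b addeC muleA -EFinM.
by rewrite [_ * 2]mulrC mulrA.
Qed.

Lemma sum_alternating_bin n : (0 < n)%N -> \sum_(m < n.+1) (-1) ^+ m * 'C(n, m)%:R = 0 :> R.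
Proof.
move=> n0; have := exprBn (1 : R) 1 n; rewrite subrr expr0n gtn_eqF// => H.
rewrite [RHS]H; apply: eq_bigr => i _.
by rewrite !expr1n !mulr1 mulr_natr.
Qed.

Definition varkappa_sum k n : R := \sum_(m < n.+1) (-1) ^+ m * 'C(n, m)%:R * (m%:R : R) `^ k.

(** The weight is homogeneous of degree [- (1 + k)] and the substitution contributes [1 / m], which
    leaves [m^k]. For [m = 0] both sides vanish, by [p 0 = 0] and, since [k != 0], by [0^k = 0]. *)
Lemma integral_dilated_weight k p (m : nat) : k != 0 -> p 0 = 0 ->
  mu.-integrable setT (fun t => (p t * marchaud_weight k t)%:E) ->
  mu.-integrable setT (fun t => (p (m%:R * t) * marchaud_weight k t)%:E) /\
  (\int[mu]_t (p (m%:R * t) * marchaud_weight k t)%:E =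
   (m%:R `^ k)%:E * \int[mu]_t (p t * marchaud_weight k t)%:E)%E.
Proof.
move=> k0 p0 ip.
case: m => [|m].
  have -> : (fun t => (p (0%:R * t) * marchaud_weight k t)%:E) = cst 0%E.
    by apply/funext => t; rewrite mul0r p0 mul0r.
  rewrite powR0// mul0e; split; first exact: integrable0.
  by rewrite integral0.
have m0 : 0 < m.+1%:R :> R by rewrite ltr0n.
have [E I] := integral_affine 0 m0 ip.
have wE t : marchaud_weight k t =
    m.+1%:R `^ (1 + k) * marchaud_weight k (m.+1%:R * t + 0).
  rewrite addr0; have [t0|t0] := leP t 0.
    by rewrite !marchaud_weight0 ?mulr0// pmulr_rle0.
  rewrite !marchaud_weight_pos ?mulr_gt0// powRM ?ler0n ?(ltW t0)// mulrA.
  by rewrite (powRN m.+1%:R) mulfV ?mul1r// powR_eq0 negb_and gt_eqF.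
have -> : (fun t => (p (m.+1%:R * t) * marchaud_weight k t)%:E) =
   (fun t => (m.+1%:R `^ (1 + k))%:E *
     (p (m.+1%:R * t + 0) * marchaud_weight k (m.+1%:R * t + 0))%:E)%E.
  apply/funext => t; rewrite wE -EFinM; congr (_%:E).
  by rewrite addr0; ring.
split; first exact: integrableZl.
have eM : m.+1%:R `^ (1 + k) = m.+1%:R `^ k * m.+1%:R :> R.
  by rewrite powRD ?(gt_eqF m0) ?implybT// powRr1 ?ler0n// mulrC.
rewrite (integralZl measurableT I).
have aux (J J' : \bar R) : J = (m.+1%:R%:E * J')%E ->
    ((m.+1%:R `^ (1 + k))%:E * J' = (m.+1%:R `^ k)%:E * J)%E.
  by move=> ->; rewrite eM EFinM muleA.
exact: aux E.
Qed.

(** Absolute convergence for [p] allows the alternating sum to be integrated term by term, and each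
    term is a dilation. It is applied to [f (x + t) - f x] and to [1 - exp (- t)]. *)
Lemma integral_difference_weight k p n : k != 0 -> p 0 = 0 ->
  mu.-integrable setT (fun t => (p t * marchaud_weight k t)%:E) ->
  (\int[mu]_t ((\sum_(m < n.+1) (-1) ^+ m * 'C(n, m)%:R * p (m%:R * t)) * marchaud_weight k t)%:E =
  (varkappa_sum k n)%:E * \int[mu]_t (p t * marchaud_weight k t)%:E)%E.
Proof.
move=> k0 p0 ip.
pose c (m : 'I_n.+1) : R := (-1) ^+ m * 'C(n, m)%:R.
have -> : (fun t => ((\sum_(m < n.+1) (-1) ^+ m * 'C(n, m)%:R * p (m%:R * t)) * marchaud_weight k t)%:E) =
   (fun t => \sum_(m < n.+1) (c m)%:E * (p (m%:R * t) * marchaud_weight k t)%:E)%E.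
  apply/funext => t; rewrite mulr_suml -sumEFin; apply: eq_bigr => m _.
  by rewrite -EFinM /c !mulrA.
rewrite integral_sum//; last first.
  by move=> m; apply: integrableZl => //; have [] := integral_dilated_weight m k0 p0 ip.
have fin : (\int[mu]_t (p t * marchaud_weight k t)%:E)%E \is a fin_num.
  exact: integrable_fin_num.
rewrite -(fineK fin) /varkappa_sum -EFinM mulr_suml -sumEFin; apply: eq_bigr => m _.
have [i e] := integral_dilated_weight m k0 p0 ip.
by rewrite integralZl// e -[in LHS](fineK fin) -!EFinM mulrA.
Qed.

Lemma integrable_near_far k h : 0 < k -> k < 1 -> 0 < h ->
  mu.-integrable setT (fun t => (near_weight k h t + far_weight k h t)%:E).
Proof.
move=> k0 k1 h0.
have i1 : mu.-integrable setT (fun t => (near_weight k h t)%:E).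
  apply/integrableP; split; first by apply/measurable_EFinP; exact: measurable_near_weight.
  under eq_integral do rewrite gee0_abs ?lee_fin ?near_weight_ge0//.
  by rewrite integral_near_weight// ltry.
have i2 : mu.-integrable setT (fun t => (far_weight k h t)%:E).
  apply/integrableP; split; first by apply/measurable_EFinP; exact: measurable_far_weight.
  under eq_integral do rewrite gee0_abs ?lee_fin ?far_weight_ge0//.
  by rewrite integral_far_weight// ltry.
exact: (integrableD measurableT i1 i2).
Qed.

(* For [p t = 1 - exp (- t)] the alternating sum of the [p (m t)] is
   [- (p t)^n], which has constant sign. *)
Lemma varkappa_sum_neq0 k n : 0 < k -> k < 1 -> (0 < n)%N -> varkappa_sum k n != 0.
Proof.
move=> k0 k1 n0; apply/eqP => S0.
pose p t : R := 1 - expR (- t).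
have p00 : p 0 = 0 by rewrite /p oppr0 expR0 subrr.
have pge0 t : 0 < t -> 0 < p t.
  by move=> t0; rewrite subr_gt0 -expR0 ltr_expR oppr_lt0.
have mp : measurable_fun setT p.
  apply: measurable_funB => //; apply: measurableT_comp => //.
have ip : mu.-integrable setT (fun t => (p t * marchaud_weight k t)%:E).
  apply: le_integrable (integrable_near_far k0 k1 ltr01) => //.
    apply/measurable_EFinP; apply: measurable_funM => //; exact: measurable_marchaud_weight.
  move=> t _; have [t0|t0] := leP t 0.
    by rewrite marchaud_weight0// mulr0 abse0.
  have pw0 : 0 <= p t * marchaud_weight k t.
    by rewrite mulr_ge0 ?marchaud_weight_ge0// ltW// pge0.
  have nf0 : 0 <= near_weight k 1 t + far_weight k 1 t.
    by rewrite addr_ge0 ?near_weight_ge0 ?far_weight_ge0.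
  rewrite !gee0_abs ?lee_fin//.
  (* With [a = b = 1] the splitting expresses [p t <= min (1, t)]. *)
  have := @weight_le_near_far k 1 1%E 1%E (p t)%:E t ltr01.
  rewrite -!EFinM !mulr1 -EFinD !lee_fin mulrC; apply => //.
  - exact/ltW/pge0.
  - by rewrite /p; have := expR_ge0 (- t); lra.
  - by move=> _; rewrite /p; have := expR_ge1Dx (- t); lra.
have := integral_difference_weight n (lt0r_neq0 k0) p00 ip.
rewrite S0 mul0e => I0.
pose q t : R := p t ^+ n * marchaud_weight k t.
have qE t : (\sum_(m < n.+1) (-1) ^+ m * 'C(n, m)%:R * p (m%:R * t)) * marchaud_weight k t = - q t.
  rewrite /q -mulNr; congr (_ * _); rewrite /p.
  under eq_bigr do rewrite mulrBr mulr1.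
  rewrite sumrB sum_alternating_bin// sub0r exprBn; congr (- _).
  apply: eq_bigr => m _; rewrite expr1n mulr1 -mulrA -[RHS]mulr_natr -mulrA; congr (_ * _).
  by rewrite mulrC -mulrN expRM_natl.
have q0 t : 0 <= q t.
  have [t0|t0] := leP t 0; first by rewrite /q marchaud_weight0// mulr0.
  by rewrite /q mulr_ge0 ?marchaud_weight_ge0// exprn_ge0// ltW// pge0.
have mq : measurable_fun setT q.
  apply: measurable_funM; last exact: measurable_marchaud_weight.
  exact: measurable_funX.
have : (0 < \int[mu]_(t in setT) (q t)%:E)%E.
  apply: integral_gt0_itv => // t /andP[t0 _].
  by rewrite mulr_gt0 ?exprn_gt0 ?pge0// marchaud_weight_pos// powR_gt0.
suff -> : (\int[mu]_(t in setT) (q t)%:E = 0)%E by rewrite ltxx.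
have : (\int[mu]_(t in setT) - (q t)%:E = 0)%E.
  by rewrite -[RHS]I0; apply: eq_integral => t _; rewrite qE.
rewrite integral_ge0N; last by move=> t _; rewrite lee_fin.
by move=> H; rewrite -[LHS]oppeK H oppe0.
Qed.

(** Tonelli gives measurability for the positive and negative parts separately. Sections need not be
    integrable: the difference is taken in the extended reals, as befits Marchaud integrals that may
    diverge at some [x]. *)
Lemma measurable_integral_prod (g : R * R -> \bar R) : measurable_fun setT g ->
  measurable_fun setT (fun x => \int[mu]_y g (x, y))%E.
Proof.
move=> mg.
rewrite (_ : (fun x => _) = (fun x => \int[mu]_y g^\+ (x, y) - \int[mu]_y g^\- (x, y))%E).
  apply: emeasurable_funB.
    have := measurable_fun_fubini_tonelli_F (m2 := mu) g^\+%E (measurable_funepos mg).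
    exact.
  have := measurable_fun_fubini_tonelli_F (m2 := mu) g^\-%E (measurable_funeneg mg).
  exact.
apply/funext => x; rewrite integralE.
by congr (_ - _)%E; apply: eq_integral => y _; rewrite ?funeposE ?funenegE.
Qed.

Lemma L1norm_EFin f : L1norm (EFin \o f) = L1n f.
Proof. by rewrite /L1norm Lnorm1. Qed.

Lemma L1_11P f : L1_11 f -> [/\ loc_abs_continuous f, measurable_fun setT f,
  measurable_fun setT (derive1 f), L1n f \is a fin_num & L1n (derive1 f) \is a fin_num].
Proof.
move=> [acf f1 f'1].
have /integrableP[mf intf] := (Lfun1_integrable mu f).1 f1.
have /integrableP[mf' intf'] := (Lfun1_integrable mu (derive1 f)).1 f'1.
split => //; try exact/measurable_EFinP; by rewrite ge0_fin_numE ?L1n_ge0.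
Qed.

Lemma integrable_marchaud_kernel k f : 0 < k -> k < 1 -> L1_11 f ->
  (mu \x mu)%E.-integrable setT (EFin \o marchaud_kernel k f).
Proof.
move=> k0 k1 /L1_11P[acf mf mf' finf finf'].
apply/integrable12ltyP; first by apply/measurable_EFinP; exact: measurable_marchaud_kernel.
apply: le_lt_trans (marchaud_kernel_bound k0 k1 ltr01 acf mf mf') _.
by rewrite -(fineK finf) -(fineK finf') -!EFinM -EFinD ltry.
Qed.

Lemma measurable_marchaud k n f : measurable_fun setT f ->
  measurable_fun setT (marchaud k n f).
Proof.
move=> mf.
rewrite (_ : marchaud k n f = (fun x => ((varkappa k n)^-1)%:E *
  \int[mu]_t (Delta_minus n t f x * marchaud_weight k t)%:E)%E); last first.
  apply/funext => x; rewrite /marchaud; congr (_ * _)%E.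
  exact: (integral_weight (fun t => Delta_minus n t f x)).
apply: measurable_funeM.
pose g (z : R * R) : \bar R := (Delta_minus n z.2 f z.1 * marchaud_weight k z.2)%:E.
have mg : measurable_fun setT g.
  apply/measurable_EFinP; apply: measurable_funM; last first.
    apply: (measurableT_comp (measurable_marchaud_weight k)); exact: measurable_snd.
  apply: measurable_sum => m; apply: measurable_funM => //.
  apply: (measurableT_comp mf); apply: measurable_funD; first exact: measurable_fst.
  by apply: measurable_funM => //; exact: measurable_snd.
exact: (measurable_integral_prod mg).
Qed.

(** For almost every [x] the section of the kernel is integrable. Subtracting [f x] does not change
    the difference of order [n], since the alternating binomials sum to 0, and makes [p 0 = 0]. The
    factor [varkappa_sum] then cancels; the sign of [Gamma (- k) = - Gamma (1 - k) / k] is absorbed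
    by the kernel, which contains [- p]. *)
Lemma marchaud_ae k n f : 0 < k -> k < 1 -> (0 < n)%N -> L1_11 f ->
  {ae mu, forall x, marchaud k n f x =
    (k / Gamma (1 - k))%:E * \int[mu]_t (marchaud_kernel k f (x, t))%:E}%E.
Proof.
move=> k0 k1 n0 f11.
have := ae_integrable1 (integrable_marchaud_kernel k0 k1 f11).
apply: filterS => x ix.
have kn0 : k != 0 by rewrite gt_eqF.
pose p t := f (x + t) - f x.
have p0 : p 0 = 0 by rewrite /p addr0 subrr.
have pE : (fun t => (p t * marchaud_weight k t)%:E) =
    (fun t => (-1)%:E * (marchaud_kernel k f (x, t))%:E)%E.
  by apply/funext => t; rewrite -EFinM /marchaud_kernel/= /p; congr (_%:E); ring.
have ip : mu.-integrable setT (fun t => (p t * marchaud_weight k t)%:E).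
  by rewrite pE; exact: integrableZl.
have DE t : Delta_minus n t f x = \sum_(m < n.+1) (-1) ^+ m * 'C(n, m)%:R * p (m%:R * t).
  rewrite /p; under [RHS]eq_bigr do rewrite mulrBr.
  by rewrite sumrB -mulr_suml sum_alternating_bin// mul0r subr0.
rewrite /marchaud (integral_weight (fun t => Delta_minus n t f x)).
under eq_integral do rewrite DE.
rewrite (integral_difference_weight n kn0 p0 ip) pE integralZl//.
have fin : (\int[mu]_t (marchaud_kernel k f (x, t))%:E)%E \is a fin_num.
  exact: (integrable_fin_num measurableT ix).
rewrite -(fineK fin) -!EFinM; congr (_%:E).
have vE : varkappa k n = - (Gamma (1 - k) / k) * varkappa_sum k n.
  by rewrite /varkappa Gamma_neg.
have G0 : Gamma (1 - k) != 0.
  by rewrite gt_eqF// Gamma_gt0 ?subr_gt0// gerBl ltW.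
rewrite vE; field.
by rewrite G0 kn0 varkappa_sum_neq0.
Qed.

(** The norm for order 1, freed of the factor [k / Gamma (1 - k)]; the order [n] has disappeared. *)
Definition marchaud_L1 k f : \bar R :=
  (\int[mu]_x `|\int[mu]_t (marchaud_kernel k f (x, t))%:E|)%E.

Lemma L1norm_marchaud k n f : 0 < k -> k < 1 -> (0 < n)%N -> L1_11 f ->
  L1norm (marchaud k n f) = ((k / Gamma (1 - k))%:E * marchaud_L1 k f)%E.
Proof.
move=> k0 k1 n0 f11; have [_ mf _ _ _] := L1_11P f11.
have mI : measurable_fun setT (fun x => \int[mu]_t (marchaud_kernel k f (x, t))%:E)%E.
  have := @measurable_integral_prod (EFin \o marchaud_kernel k f).
  by apply; apply/measurable_EFinP; exact: measurable_marchaud_kernel.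
have c0 : 0 <= k / Gamma (1 - k).
  by rewrite divr_ge0 ?(ltW k0)// ltW// Gamma_gt0 ?subr_gt0// gerBl ltW.
rewrite /L1norm Lnorm1 /marchaud_L1 -ge0_integralZl//; last exact: measurableT_comp.
apply: ge0_ae_eq_integral => //.
- by apply: measurableT_comp => //; exact: measurable_marchaud.
- by apply: measurable_funeM; exact: measurableT_comp.
- by move=> x _; rewrite mule_ge0// lee_fin.
have := marchaud_ae k0 k1 n0 f11.
apply: filterS; first exact: (ae_filter_ringOfSetsType mu).
by move=> x E _; rewrite E abseM gee0_abs// lee_fin.
Qed.

Lemma marchaud_L1_le k h f : 0 < k -> k < 1 -> 0 < h -> L1_11 f ->
  (marchaud_L1 k f <= (2 * h `^ (- k) / k)%:E * L1n f +
   (h `^ (1 - k) / (1 - k))%:E * L1n (derive1 f))%E.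
Proof.
move=> k0 k1 h0 f11; have [acf mf mf' _ _] := L1_11P f11.
apply: le_trans (marchaud_kernel_bound k0 k1 h0 acf mf mf').
have mK : measurable_fun setT (EFin \o marchaud_kernel k f).
  by apply/measurable_EFinP; exact: measurable_marchaud_kernel.
apply: ge0_le_integral => //.
- by apply: measurableT_comp => //; exact: (measurable_integral_prod mK).
- have mA : measurable_fun setT (abse \o (EFin \o marchaud_kernel k f)).
    exact: measurableT_comp.
  exact: (measurable_integral_prod mA).
- move=> x _; apply: le_abse_integral => //.
  by apply: (measurableT_comp mK); exact: measurable_pair1.
Qed.

Lemma additive_marchaud k h n : 0 < k -> k < 1 -> (0 < n)%N -> 0 < h ->
  @additive_ineq R k n (2 * h `^ (- k) / Gamma (1 - k)) (k * h `^ (1 - k) / Gamma (2 - k)).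
Proof.
move=> k0 k1 n0 h0 f f11; rewrite L1norm_marchaud// !L1norm_EFin.
have [_ _ _ fin fin'] := L1_11P f11.
have k10 : 0 < 1 - k by rewrite subr_gt0.
have k11 : 1 - k <= 1 by rewrite gerBl ltW.
have G0 := Gamma_gt0 k10 k11.
have -> : Gamma (2 - k) = (1 - k) * Gamma (1 - k).
  by rewrite -Gamma_rec//; congr Gamma; ring.
have H := marchaud_L1_le k0 k1 h0 f11.
have c0 : (0 <= (k / Gamma (1 - k))%:E)%E by rewrite lee_fin divr_ge0// ltW.
apply: le_trans (lee_wpmul2l c0 H) _.
case: (L1n f) fin => // a _; case: (L1n (derive1 f)) fin' => // b _.
rewrite le_eqVlt; apply/orP; left; apply/eqP; congr (_%:E).
by field; rewrite !gt_eqF.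
Qed.

End shifts.

(** * Optimization over the step and the multiplicative inequality *)

Section multiplicative.
Variable R : realType.
Local Notation mu := (@lebesgue_measure R).
Implicit Types (f : R -> R) (k h d c y : R).

(** For the degenerate cases [||f|| = 0] and [||f'|| = 0], in which the infimum over [h] is
    approached as [h] tends to 0 or to infinity. *)
Lemma le0_all_mul c d : 0 <= c -> (forall y, 0 < y -> d <= c * y) -> d <= 0.
Proof.
move=> c0 H; apply/ler_addgt0Pr => e e0; rewrite add0r.
have c1 : 0 < c + 1 by rewrite ltr_wpDl.
apply: le_trans (H (e / (c + 1)) _) _; first by rewrite divr_gt0.
by rewrite mulrA ler_pdivrMr// mulrC ler_pM2l// lerDl.
Qed.

Lemma powRK s y : s != 0 -> 0 < y -> (y `^ s^-1) `^ s = y.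
Proof. by move=> s0 y0; rewrite -powRrM mulVf// powRr1// ltW. Qed.

Lemma powR1B k y : 0 < y -> y `^ (1 - k) = y * y `^ (- k).
Proof.
move=> y0; rewrite (@powRD _ y 1 (- k)) ?powRr1 ?(ltW y0)//.
by rewrite (gt_eqF y0) implybT.
Qed.

(** This [h] is the zero of the derivative in [h] of the left-hand side, which is proportional to
    [- 2 a h^(- k - 1) + b h^(- k)]. *)
Lemma optimal_step k (a b G : R) : 0 < k -> k < 1 -> 0 < a -> 0 < b -> 0 < G ->
  let h := 2 * a / b in
  2 * h `^ (- k) / G * a + k * h `^ (1 - k) / ((1 - k) * G) * b =
  2 `^ (1 - k) / ((1 - k) * G) * (a `^ (1 - k) * b `^ k).
Proof.
move=> k0 k1 a0 b0 G0 h.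
have h0 : 0 < h by rewrite divr_gt0 ?mulr_gt0.
rewrite !powR1B//.
have hE : h `^ (- k) = 2 `^ (- k) * a `^ (- k) * b `^ k.
  rewrite /h powRM ?mulr_ge0 ?invr_ge0 ?ltW// powRM ?ltW//.
  by rewrite -(powR_inv1 (ltW b0)) -powRrM mulN1r opprK.
rewrite hE /h; field.
by rewrite !gt_eqF// subr_gt0.
Qed.

Lemma multiplicative_marchaud k n : 0 < k -> k < 1 -> (0 < n)%N ->
  @multiplicative_ineq R k n (2 `^ (1 - k) / Gamma (2 - k)).
Proof.
move=> k0 k1 n0 f f11.
have A h (h0 : 0 < h) := @additive_marchaud R k h n k0 k1 n0 h0 f f11.
have [_ _ _ fin fin'] := L1_11P f11.
have k10 : 0 < 1 - k by rewrite subr_gt0.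
have G0 := Gamma_gt0 k10 (ltW (ltac:(by rewrite gtrBl) : 1 - k < 1)).
have GE : Gamma (2 - k) = (1 - k) * Gamma (1 - k).
  by rewrite -Gamma_rec//; [congr Gamma; ring|rewrite gerBl ltW].
rewrite GE in A *.
have D0 : (0 <= L1norm (marchaud k n f))%E by exact: Lnorm_ge0.
rewrite !L1norm_EFin in A *.
have a0 := L1n_ge0 f; have b0 := L1n_ge0 (derive1 f).
case: (L1n f) (L1n (derive1 f)) fin fin' a0 b0 A => // a [b| |]// _ _.
rewrite !lee_fin => a0 b0 A.
(* The additive inequality at [h = 1] shows that the norm is finite, so the rest takes place among
   reals. *)
have [d dE] : exists d, L1norm (marchaud k n f) = d%:E.
  exists (fine (L1norm (marchaud k n f))); rewrite fineK// ge0_fin_numE//.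
  by apply: le_lt_trans (A 1 ltr01) _; rewrite -!EFinM -EFinD ltry.
rewrite dE in D0 A *.
have {}A h : 0 < h -> d <= 2 * h `^ (- k) / Gamma (1 - k) * a +
    k * h `^ (1 - k) / ((1 - k) * Gamma (1 - k)) * b.
  by move=> /A; rewrite -!EFinM -EFinD lee_fin.
rewrite !poweR_EFin -!EFinM lee_fin.
(* Here only the term in [h^(1 - k)] survives; [h = y^(1 / (1 - k))] turns it into a multiple of an
   arbitrary [y > 0]. *)
have [a00|an0] := eqVneq a 0.
  rewrite a00 powR0 ?gt_eqF// mul0r mulr0.
  apply: (@le0_all_mul (k / ((1 - k) * Gamma (1 - k)) * b)).
    by rewrite mulr_ge0// ltW// divr_gt0// mulr_gt0.
  move=> y y0; have := A (y `^ (1 - k)^-1); rewrite powR_gt0// => /(_ isT).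
  rewrite a00 mulr0 add0r powRK ?gt_eqF// => /le_trans; apply.
  by rewrite le_eqVlt; apply/orP; left; apply/eqP; ring.
(* Here only the term in [h^(- k)] survives; [h = y^(- 1 / k)] makes it a multiple of [y], and small
   [y] means large [h]. *)
have [b00|bn0] := eqVneq b 0.
  rewrite b00 (powR0 (lt0r_neq0 k0)) !mulr0.
  apply: (@le0_all_mul (2 / Gamma (1 - k) * a)).
    by rewrite mulr_ge0// ltW// divr_gt0.
  have kN0 : - k != 0 by rewrite oppr_eq0 gt_eqF.
  move=> y y0; have := A (y `^ (- k)^-1); rewrite powR_gt0// => /(_ isT).
  rewrite b00 mulr0 addr0 powRK// => /le_trans; apply.
  by rewrite le_eqVlt; apply/orP; left; apply/eqP; ring.
have agt : 0 < a by rewrite lt_def an0.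
have bgt : 0 < b by rewrite lt_def bn0.
rewrite -optimal_step//; apply: A.
by rewrite divr_gt0 ?mulr_gt0.
Qed.
End multiplicative.

(** * Extremal trapezoids *)

Section trapezoid.
Variable R : realType.
Local Notation mu := (@lebesgue_measure R).
Implicit Types (e h x y k : R).

Definition ramp e x : R := clamp 0 1 (x / e).
(** Written as a difference of two translates of one ramp, it inherits its Lipschitz bound,
    measurability and derivative from the ramp. *)
Definition trapezoid e h x : R := ramp e x - ramp e (x - h).

Lemma ramp_homo e : 0 < e -> {homo ramp e : x y / x <= y}.
Proof. by move=> e0 x y xy; apply: clamp_homo; rewrite ler_pM2r ?invr_gt0. Qed.

Lemma ramp_le0 e x : 0 < e -> x <= 0 -> ramp e x = 0.
Proof.
move=> e0 x0; have xe : x / e <= 0 by rewrite pmulr_lle0 ?invr_gt0.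
by rewrite /ramp /clamp (min_idPl (le_trans xe ler01)) (max_idPl xe).
Qed.

Lemma ramp_mid e x : 0 < e -> 0 <= x <= e -> ramp e x = x / e.
Proof.
move=> e0 /andP[x0 xe]; rewrite /ramp clamp_id// divr_ge0 ?(ltW e0)//=.
by rewrite ler_pdivrMr// mul1r.
Qed.

Lemma ramp_ge1 e x : 0 < e -> e <= x -> ramp e x = 1.
Proof.
move=> e0 ex; have xe : 1 <= x / e by rewrite ler_pdivlMr// mul1r.
by rewrite /ramp /clamp (min_idPr xe) (max_idPr ler01).
Qed.

Lemma ramp_ge0 e x : 0 <= ramp e x. Proof. exact: clamp_ge. Qed.
Lemma ramp_le1 e x : ramp e x <= 1. Proof. exact: clamp_le. Qed.

Lemma ramp_lipschitz e x y : 0 < e -> x <= y -> `|ramp e y - ramp e x| <= (y - x) / e.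
Proof.
move=> e0 xy; rewrite ger0_norm ?subr_ge0 ?ramp_homo//.
by rewrite mulrBl clampB// ler_pM2r ?invr_gt0.
Qed.

Lemma trapezoid_ge0 e h x : 0 < e -> 0 < h -> 0 <= trapezoid e h x.
Proof. by move=> e0 h0; rewrite subr_ge0 ramp_homo// gerBl ltW. Qed.

Lemma trapezoid_le1 e h x : trapezoid e h x <= 1.
Proof. by rewrite lerBlDr (le_trans (ramp_le1 _ _))// lerDl ramp_ge0. Qed.

Lemma trapezoid_left e h x : 0 < e -> 0 < h -> x <= 0 -> trapezoid e h x = 0.
Proof. by move=> e0 h0 x0; rewrite /trapezoid !ramp_le0// ?subr0//; lra. Qed.

Lemma trapezoid_right e h x : 0 < e -> 0 < h -> h + e <= x -> trapezoid e h x = 0.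
Proof. by move=> e0 h0 x0; rewrite /trapezoid !ramp_ge1 ?subrr//; lra. Qed.

Lemma trapezoid_top e h x : 0 < e -> e <= x <= h -> trapezoid e h x = 1.
Proof.
by move=> e0 /andP[ex xh]; rewrite /trapezoid ramp_ge1// ramp_le0 ?subr0//; lra.
Qed.

Lemma loc_ac_trapezoid e h : 0 < e -> loc_abs_continuous (trapezoid e h).
Proof.
(* Each ramp is Lipschitz with constant [1 / e], hence the trapezoid with constant [2 / e]. *)
move=> e0 a b ab r r0; exists (r * e / 2); first by rewrite divr_gt0 ?mulr_gt0.
move=> N l u lu _ H.
apply: (@le_lt_trans _ _ (\sum_(i < N) 2 / e * (u i - l i))).
  apply: ler_sum => i _; have [_ [liui _]] := lu i.
  rewrite /trapezoid.
  have -> : ramp e (u i) - ramp e (u i - h) - (ramp e (l i) - ramp e (l i - h)) =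
    (ramp e (u i) - ramp e (l i)) - (ramp e (u i - h) - ramp e (l i - h)) by ring.
  apply: le_trans (ler_normB _ _) _.
  have h1 := ramp_lipschitz e0 liui.
  have : l i - h <= u i - h by rewrite lerB.
  move=> /(ramp_lipschitz e0); have -> : u i - h - (l i - h) = u i - l i by ring.
  move=> h2; apply: le_trans (lerD h1 h2) _.
  by rewrite le_eqVlt; apply/orP; left; apply/eqP; ring.
rewrite -mulr_sumr -ltr_pdivlMl ?divr_gt0//.
apply: lt_le_trans H _; rewrite le_eqVlt; apply/orP; left; apply/eqP.
by rewrite invf_div; ring.
Qed.

Lemma continuous_ramp e : continuous (ramp e).
Proof.
move=> x; rewrite /ramp /clamp.
apply: (@continuous_comp _ _ _ (fun x => x / e) (fun y => Num.max 0 (Num.min y 1))).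
  by apply: cvgMl; exact: cvg_id.
apply: continuous_max; first exact: cst_continuous.
by apply: continuous_min; [exact: cvg_id|exact: cst_continuous].
Qed.

Lemma measurable_trapezoid e h : measurable_fun setT (trapezoid e h).
Proof.
have mr : measurable_fun setT (ramp e).
  by apply: continuous_measurable_fun; exact: continuous_ramp.
apply: measurable_funB => //; apply: (measurableT_comp mr).
exact: measurable_funB.
Qed.

Definition ramp_slope e x : R := e^-1 * \1_(`]0, e[%classic : set R) x.

Lemma is_derive_ramp e x : 0 < e -> x != 0 -> x != e ->
  is_derive x (1 : R) (ramp e) (ramp_slope e x).
Proof.
move=> e0 x0 xe; rewrite /ramp_slope indicE mem_setE in_itv/=.
have [xneg|xpos|x00] := ltgtP x 0; last by rewrite x00 eqxx in x0.
  rewrite mulr0; apply: near_eq_is_derive (is_derive_cst 0 x 1).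
  by near=> y; rewrite ramp_le0//; apply: ltW; near: y; exact: lt_nbhsl.
have [xle|xge|xe0] := ltgtP x e; [| |by rewrite xe0 eqxx in xe]; last first.
  rewrite andbF mulr0; apply: near_eq_is_derive (is_derive_cst (1 : R) x 1).
  by near=> y; rewrite ramp_ge1//; apply: ltW; near: y; exact: lt_nbhsr.
rewrite mulr1; apply: (@near_eq_is_derive _ _ _ (e^-1 \*: id)).
  near=> y; rewrite ramp_mid//= 1?mulrC//; apply/andP; split; apply: ltW; near: y.
    exact: lt_nbhsr.
  exact: lt_nbhsl.
by apply: is_derive_eq; rewrite /GRing.scale/= mulr1.
Unshelve. all: by end_near. Qed.

(** The possible points of non-derivability, where the total function [derive1] may take its default
    value; formulas for the derivative are stated off this finite set. *)
Definition corners e h : set R := [set x | x \in [:: 0; e; h; h + e]].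

Lemma derive1_trapezoid e h x : 0 < e -> ~ corners e h x ->
  derive1 (trapezoid e h) x = ramp_slope e x - ramp_slope e (x - h).
Proof.
move=> e0 /negP; rewrite !inE !negb_or => /and4P[x0 xe xh xhe].
have d1 := is_derive_ramp e0 x0 xe.
have xh0 : x - h != 0 by rewrite subr_eq0.
have xhe' : x - h != e by rewrite subr_eq addrC.
have d2 := is_derive_ramp e0 xh0 xhe'.
have d4 : is_derive x (1 : R) (fun y => ramp e (y - h)) (ramp_slope e (x - h) * 1).
  exact: (@is_derive1_comp _ (ramp e) (shift (- h)) x _ _ d2 (is_derive_shift x 1 (- h))).
rewrite derive1E /trapezoid.
have d5 := is_deriveB d1 d4.
by rewrite (@derive_val _ _ _ _ _ _ _ d5) mulr1.
Qed.

Lemma countable_corners e h : countable (corners e h).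
Proof. by apply: finite_set_countable; exact: finite_seq. Qed.

(** Preimages under [f] and [g] differ only inside [A], and every subset of a countable set is
    Borel. *)
Lemma measurable_fun_off_countable (A : set R) (f g : R -> R) : countable A ->
  measurable_fun setT g -> (forall x, ~ A x -> f x = g x) -> measurable_fun setT f.
Proof.
move=> cA mg fg _ B mB; rewrite setTI.
have mAB (C : set R) : C `<=` A -> measurable C.
  move=> CA; apply: countable_measurable => //.
  exact: sub_countable (subset_card_le CA) cA.
have -> : f @^-1` B = (g @^-1` B `\` A) `|` (f @^-1` B `&` A).
  apply/seteqP; split=> [x Bfx|x [[Bgx nAx]|[]//]]; last by rewrite /= fg.
  have [Ax|nAx] := pselect (A x); first by right.
  by left; split=> //=; rewrite -fg.
apply: measurableU; last by apply: mAB => x [].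
apply: measurableD; last exact: mAB.
by rewrite -[X in measurable X]setTI; exact: mg.
Qed.

Lemma measurable_ramp_slope e : measurable_fun setT (ramp_slope e).
Proof. by apply: measurable_funM => //; exact: measurable_indic. Qed.

Lemma measurable_derive1_trapezoid e h : 0 < e ->
  measurable_fun setT (derive1 (trapezoid e h)).
Proof.
move=> e0; apply: (measurable_fun_off_countable (countable_corners e h)); last first.
  by move=> x; exact: derive1_trapezoid.
apply: measurable_funB; first exact: measurable_ramp_slope.
apply: (measurableT_comp (measurable_ramp_slope e)); exact: measurable_funB.
Qed.

Lemma integral_ramp_slope e h : 0 < e ->
  (\int[mu]_x (ramp_slope e (x - h))%:E = 1)%E.
Proof.
move=> e0.
rewrite (@ge0_integral_shift _ (EFin \o ramp_slope e) (- h))//; last 2 first.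
- by apply/measurable_EFinP; exact: measurable_ramp_slope.
- by move=> x; rewrite lee_fin mulr_ge0// invr_ge0 ltW.
rewrite -(integral_indicM `]0, e[%classic (fun=> e^-1)) integral_cst//=.
by rewrite lebesgue_measure_itv/= lte_fin e0 -EFinB -EFinM subr0 mulVf// gt_eqF.
Qed.

(** Each ramp contributes an integral of slope equal to 1. An upper bound is enough, because this
    norm occurs on the right of inequalities whose left side is bounded below. *)
Lemma L1n_derive1_trapezoid e h : 0 < e -> (L1n (derive1 (trapezoid e h)) <= 2%:E)%E.
Proof.
move=> e0.
have ms a : measurable_fun setT (fun x => (ramp_slope e (x - a))%:E : \bar R).
  apply/measurable_EFinP; apply: (measurableT_comp (measurable_ramp_slope e)).
  exact: measurable_funB.
have s0 x : 0 <= ramp_slope e x by rewrite mulr_ge0// invr_ge0 ltW.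
have -> : 2%:E = (\int[mu]_x ((ramp_slope e (x - 0))%:E + (ramp_slope e (x - h))%:E))%E.
  rewrite ge0_integralD; [|by []|by move=> x _; rewrite lee_fin|exact: ms
    |by move=> x _; rewrite lee_fin|exact: ms].
  by rewrite !integral_ramp_slope// -EFinD.
apply: ae_ge0_le_integral => //.
- by apply/measurable_EFinP; apply: measurableT_comp => //; exact: measurable_derive1_trapezoid.
- by move=> x _; rewrite adde_ge0// lee_fin.
- exact: (emeasurable_funD (ms 0) (ms h)).
exists (corners e h); split.
- exact: countable_measurable (countable_corners e h).
- exact: countable_lebesgue_measure0 (countable_corners e h).
move=> x /= H; apply: contrapT => nc; apply: H => _.
rewrite derive1_trapezoid// subr0 -EFinD lee_fin.
by rewrite (le_trans (ler_normB _ _))// !ger0_norm.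
Qed.

Lemma L1n_trapezoid e h : 0 < e -> 0 < h -> (L1n (trapezoid e h) <= (h + e)%:E)%E.
Proof.
move=> e0 h0.
have -> : (h + e)%:E = (\int[mu]_x (\1_(`[0, h + e]%classic : set R) x)%:E)%E.
  rewrite integral_indic//= setIT lebesgue_measure_itv/= lte_fin addr_gt0//.
  by rewrite -EFinB subr0.
apply: ge0_le_integral => //.
- by apply/measurable_EFinP; apply: measurableT_comp => //; exact: measurable_trapezoid.
- by apply/measurable_EFinP; exact: measurable_indic.
move=> x _; rewrite lee_fin indicE mem_setE in_itv/=.
have [x0|x0] := leP 0 x; last by rewrite trapezoid_left ?normr0 ?(ltW x0).
have [xh|xh] := leP x (h + e); last by rewrite trapezoid_right ?normr0 ?(ltW xh).
by rewrite ger0_norm ?trapezoid_ge0// trapezoid_le1.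
Qed.

Lemma L1_11_trapezoid e h : 0 < e -> 0 < h -> L1_11 (trapezoid e h).
Proof.
move=> e0 h0; split; first exact: loc_ac_trapezoid.
- apply/Lfun1_integrable/integrableP; split.
    by apply/measurable_EFinP; exact: measurable_trapezoid.
  by apply: le_lt_trans (L1n_trapezoid e0 h0) _; rewrite ltry.
- apply/Lfun1_integrable/integrableP; split.
    by apply/measurable_EFinP; exact: measurable_derive1_trapezoid.
  by apply: le_lt_trans (L1n_derive1_trapezoid h e0) _; rewrite ltry.
Qed.

End trapezoid.

(** * Lower bounds for the constants *)

Section sharpness.
Variable R : realType.
Local Notation mu := (@lebesgue_measure R).
Implicit Types (f : R -> R) (e h x k A B : R).

(** By Fubini the integral in [x] comes first, and [f] and its translate by [t] have the same
    integral. *)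
Lemma integral_marchaud_kernel k f : 0 < k -> k < 1 -> L1_11 f ->
  (\int[mu]_x \int[mu]_t (marchaud_kernel k f (x, t))%:E = 0)%E.
Proof.
move=> k0 k1 f11; have iK := integrable_marchaud_kernel k0 k1 f11.
have [_ mf _ fin _] := L1_11P f11.
have if1 : mu.-integrable setT (EFin \o f).
  by case: f11 => _ /Lfun1_integrable.
have := Fubini iK; rewrite /= => ->.
apply: integral0_eq => t _.
have [E ift] := integral_affine t ltr01 if1.
have iftt : mu.-integrable setT (fun x => (f (x + t))%:E).
  by move: ift; under eq_fun do rewrite mul1r.
transitivity (\int[mu]_x ((marchaud_weight k t)%:E * ((f x)%:E - (f (x + t))%:E)))%E.
  by apply: eq_integral => x _; rewrite /marchaud_kernel/= -EFinB -EFinM mulrC.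
rewrite integralZl//; last exact: integrableB.
rewrite integralB_EFin//.
move: E; rewrite mul1e; under [X in _ = X -> _]eq_integral do rewrite mul1r.
move=> /= <-; rewrite subee ?mule0//.
exact: (integrable_fin_num measurableT if1).
Qed.

(* The integral of [I] over the complement of [S] is the opposite of the one over [S]. *)
Lemma integral_abse_ge (I : R -> \bar R) (S : set R) : mu.-integrable setT I ->
  (\int[mu]_x I x = 0)%E -> measurable S ->
  (2%:E * \int[mu]_(x in S) I x <= \int[mu]_x `|I x|)%E.
Proof.
move=> iI I0 mS.
have iIS : mu.-integrable S I by exact: integrableS iI.
have mSC : measurable (~` S) by exact: measurableC.
have iIC : mu.-integrable (~` S) I by exact: integrableS iI.
have dS : [disjoint S & ~` S] by exact/disj_setPCl.
have fS : (\int[mu]_(x in S) I x)%E \is a fin_num by exact: integrable_fin_num.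
have ICE : (\int[mu]_(x in ~` S) I x = - \int[mu]_(x in S) I x)%E.
  have fC : (\int[mu]_(x in ~` S) I x)%E \is a fin_num by exact: integrable_fin_num.
  move: I0; rewrite -(setUv S) integral_setU//; last by rewrite setUv; exact: measurable_int iI.
  rewrite -(fineK fS) -(fineK fC) -EFinD => -[] /eqP.
  by rewrite addrC addr_eq0 => /eqP ->.
rewrite -[X in (\int[mu]_(x in X) `|I x|)%E](setUv S) ge0_integral_setU//; last first.
  by rewrite setUv; apply: measurableT_comp => //; exact: measurable_int iI.
rewrite mule_natl mule2n; apply: leeD.
  apply: le_trans (lee_abs _) _.
  have mI := measurable_int _ iIS.
  have H := le_abse_integral mu mS mI.
  exact: H.
apply: le_trans (le_abse_integral mu mSC (measurable_int _ iIC)).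
by rewrite ICE abseN lee_abs.
Qed.

Lemma marchaud_L1_ge k f (S : set R) : 0 < k -> k < 1 -> L1_11 f -> measurable S ->
  (2%:E * \int[mu]_(x in S) \int[mu]_t (marchaud_kernel k f (x, t))%:E <= marchaud_L1 k f)%E.
Proof.
move=> k0 k1 f11; apply: integral_abse_ge; last exact: integral_marchaud_kernel.
exact: integrable_fubini_F (integrable_marchaud_kernel k0 k1 f11).
Qed.

(** On the plateau the trapezoid equals its maximum 1, so the kernel is nonnegative and discarding
    [t <= h + e - x] only lowers the integral. *)
Lemma marchaud_kernel_trapezoid k e h x : 0 < k -> 0 < e -> e <= x <= h ->
  (((h + e - x) `^ (- k) / k)%:E <=
   \int[mu]_t (marchaud_kernel k (trapezoid e h) (x, t))%:E)%E.
Proof.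
move=> k0 e0 exh; have /andP[ex xh] := exh.
have h0 : 0 < h by exact: lt_le_trans (lt_le_trans e0 ex) xh.
have d0 : 0 < h + e - x by rewrite subr_gt0; lra.
rewrite -integral_far_weight//.
apply: ge0_le_integral => //.
- by move=> t _; rewrite lee_fin far_weight_ge0.
- by apply/measurable_EFinP; exact: measurable_far_weight.
- apply/measurable_EFinP.
  have mK := measurable_marchaud_kernel k (measurable_trapezoid e h).
  by apply: (measurableT_comp mK); exact: measurable_pair1.
move=> t _; rewrite lee_fin /marchaud_kernel/= (trapezoid_top e0 exh).
rewrite /far_weight indicE mem_setE in_itv/= andbT.
have [dt|dt] := ltP (h + e - x) t; last first.
  by rewrite mulr0 mulr_ge0 ?marchaud_weight_ge0// subr_ge0 trapezoid_le1.
have xt : h + e <= x + t by rewrite -lerBlDl ltW.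
by rewrite (trapezoid_right e0 h0 xt) subr0 mul1r mulr1 marchaud_weight_pos// (lt_trans d0).
Qed.

Lemma integral_reflected_powR k e h : 0 < k -> k < 1 -> 0 < e -> e < h ->
  (\int[mu]_(x in `[e, h]) ((h + e - x) `^ (- k) / k)%:E =
   ((h `^ (1 - k) - e `^ (1 - k)) / (k * (1 - k)))%:E)%E.
Proof.
move=> k0 k1 e0 eh; have k10 : 0 < 1 - k by rewrite subr_gt0.
have k1n : 1 - k != 0 by rewrite gt_eqF.
pose F x := - (k^-1 * ((h + e - x) `^ (1 - k) / (1 - k))).
have pos x : x <= h -> 0 < h + e - x by lra.
have dF x : x <= h -> is_derive x (1 : R) F ((h + e - x) `^ (- k) / k).
  move=> xh.
  have d1 := is_derive_powR_div k1n (pos x xh).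
  have d2 : is_derive x (1 : R) (fun y : R => h + e - y) (- 1).
    rewrite -[X in is_derive _ _ _ X]sub0r.
    exact: (is_deriveB (is_derive_cst (h + e) x 1) (is_derive_id x 1)).
  have d3 : is_derive x (1 : R) (fun y => (h + e - y) `^ (1 - k) / (1 - k))
      ((h + e - x) `^ (1 - k - 1) * - 1).
    exact: (@is_derive1_comp _ (fun t => t `^ (1 - k) / (1 - k)) (fun y => h + e - y) x _ _ d1 d2).
  have -> : F = (- k^-1) \*: (fun y => (h + e - y) `^ (1 - k) / (1 - k)).
    by apply/funext => y; rewrite /F /= /GRing.scale/= mulNr.
  apply: is_derive_eq; rewrite /GRing.scale/=.
  have -> : 1 - k - 1 = - k by ring.
  by ring.
have cF x : x <= h -> {for x, continuous F}.
  move=> xh; apply/differentiable_continuous/derivable1_diffP.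
  by have [] := dF x xh.
have cf x : x <= h -> {for x, continuous (fun x => (h + e - x) `^ (- k) / k)}.
  move=> xh; apply: cvgMl.
  apply: (@continuous_comp _ _ _ (fun x => h + e - x) (@powR R ^~ (- k))).
    by apply: cvgB; [exact: cvg_cst|exact: cvg_id].
  exact/continuous_powRl/pos.
rewrite (@continuous_FTC2 _ _ F)//.
- rewrite -EFinB /F; congr (_%:E).
  have -> : h + e - h = e by ring.
  have -> : h + e - e = h by ring.
  by field; rewrite k1n gt_eqF.
- apply: continuous_in_subspaceT => x /set_mem /=; rewrite in_itv/= => /andP[_ xh].
  exact: cf.
- split.
  + by move=> x; rewrite in_itv/= => /andP[_ /ltW xh]; have [] := dF x xh.
  + by apply: cvg_at_right_filter; apply: cF; exact: ltW.
  + by apply: cvg_at_left_filter; exact: cF.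
- move=> x; rewrite in_itv/= => /andP[_ /ltW xh].
  by rewrite derive1E; have d := dF x xh; rewrite (@derive_val _ _ _ _ _ _ _ d).
Qed.

Lemma marchaud_L1_trapezoid k e h : 0 < k -> k < 1 -> 0 < e -> e < h ->
  ((2 * ((h `^ (1 - k) - e `^ (1 - k)) / (k * (1 - k))))%:E <=
   marchaud_L1 k (trapezoid e h))%E.
Proof.
move=> k0 k1 e0 eh; have h0 := lt_trans e0 eh.
have f11 := L1_11_trapezoid e0 h0.
apply: le_trans (marchaud_L1_ge k0 k1 f11 (measurable_itv `[e, h])).
rewrite EFinM lee_pmul2l// -integral_reflected_powR//.
have iK := integrable_marchaud_kernel k0 k1 f11.
apply: ge0_le_integral => //.
- by move=> x _; rewrite lee_fin divr_ge0 ?powR_ge0 ?ltW.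
- apply/measurable_EFinP; apply: measurable_funM => //.
  apply: measurable_funTS; apply: (measurableT_comp (measurable_powR _)).
  exact: measurable_funB.
- have := integrable_fubini_F iK => /measurable_int H.
  exact: measurable_funTS H.
- by move=> x /=; rewrite in_itv/=; exact: marchaud_kernel_trapezoid.
Qed.

(** The passage [e -> 0] common to both inequalities: [B] becomes twice the additive constant in
    one, while the other takes [h = 1], [A = C 2^k] and [B = 0]. *)
Lemma sharp_limit k h G A B : 0 < k -> k < 1 -> 0 < h ->
  (forall e, 0 < e -> e < h -> 2 * (h `^ (1 - k) - e `^ (1 - k)) / G <= A * (h + e) + B) ->
  2 * h `^ (1 - k) / G <= A * h + B.
Proof.
move=> k0 k1 h0 H; have k10 : 0 < 1 - k by rewrite subr_gt0.
have cv : A * (h + e) + B + 2 * e `^ (1 - k) / G @[e --> 0^'+] --> A * h + B.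
  rewrite -[X in _ --> X]addr0; apply: cvgD.
    apply: cvg_at_right_filter; rewrite -[X in A * X + _]addr0.
    apply: cvgD; last exact: cvg_cst.
    by apply: cvgMr; apply: cvgD; [exact: cvg_cst|exact: cvg_id].
  rewrite -[X in _ --> X](mul0r G^-1); apply: cvgMl.
  rewrite -[X in _ --> X](mulr0 2); apply: cvgMr.
  exact: powR_cvg0.
apply: (cvgr_to_ge cv).
near=> e; have e0 : 0 < e by near: e; exact: nbhs_right_gt.
have eh : e < h by near: e; exact: nbhs_right_lt.
by have := H e e0 eh; rewrite mulrBr mulrBl lerBlDr.
Unshelve. all: by end_near. Qed.

Lemma L1norm_marchaud_trapezoid k n e h : 0 < k -> k < 1 -> (0 < n)%N ->
  0 < e -> e < h ->
  ((2 * (h `^ (1 - k) - e `^ (1 - k)) / Gamma (2 - k))%:E <=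
   L1norm (marchaud k n (trapezoid e h)))%E.
Proof.
move=> k0 k1 n0 e0 eh; have h0 := lt_trans e0 eh.
rewrite L1norm_marchaud//; last exact: L1_11_trapezoid.
have k10 : 0 < 1 - k by rewrite subr_gt0.
have k11 : 1 - k <= 1 by rewrite gerBl ltW.
have G0 := Gamma_gt0 k10 k11.
have -> : Gamma (2 - k) = (1 - k) * Gamma (1 - k).
  by rewrite -Gamma_rec//; congr Gamma; ring.
have c0 : (0 <= (k / Gamma (1 - k))%:E)%E by rewrite lee_fin divr_ge0// ltW.
apply: le_trans (lee_wpmul2l c0 (marchaud_L1_trapezoid k0 k1 e0 eh)).
rewrite -EFinM lee_fin le_eqVlt; apply/orP; left; apply/eqP.
by field; rewrite !gt_eqF.
Qed.

(** Nonnegativity of [A] and [B] allows the two norms to be replaced by their upper bounds [h + e]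
    and 2. *)
Lemma additive_ineq_lower k n h A B : 0 < k -> k < 1 -> (0 < n)%N -> 0 < h ->
  0 <= A -> 0 <= B -> additive_ineq k n A B ->
  2 * h `^ (1 - k) / Gamma (2 - k) <= A * h + B * 2.
Proof.
move=> k0 k1 n0 h0 A0 B0 H; apply: sharp_limit => // e e0 eh.
rewrite -lee_fin.
apply: le_trans (L1norm_marchaud_trapezoid k0 k1 n0 e0 eh) _.
apply: le_trans (H _ (L1_11_trapezoid e0 h0)) _.
rewrite !L1norm_EFin EFinD !EFinM; apply: leeD; apply: lee_wpmul2l; rewrite ?lee_fin//.
  exact: L1n_trapezoid.
exact: L1n_derive1_trapezoid.
Qed.

(** The inequality is invariant under dilations of [f], so the trapezoids with [h = 1] lose
    nothing. *)
Lemma multiplicative_ineq_lower k n C : 0 < k -> k < 1 -> (0 < n)%N ->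
  0 <= C -> multiplicative_ineq k n C -> 2 / Gamma (2 - k) <= C * 2 `^ k.
Proof.
move=> k0 k1 n0 C0 H; have k10 : 0 < 1 - k by rewrite subr_gt0.
have := @sharp_limit k 1 (Gamma (2 - k)) (C * 2 `^ k) 0 k0 k1 ltr01.
rewrite powR1 !mulr1 addr0; apply => e e0 e1.
have := L1norm_marchaud_trapezoid k0 k1 n0 e0 e1; rewrite powR1 addr0 => L.
rewrite -lee_fin; apply: le_trans L _.
apply: le_trans (H _ (L1_11_trapezoid e0 ltr01)) _.
have [_ _ _ fin fin'] := L1_11P (L1_11_trapezoid e0 ltr01).
rewrite !L1norm_EFin.
have a0 := L1n_ge0 (trapezoid e 1); have b0 := L1n_ge0 (derive1 (trapezoid e 1)).
have a1 := L1n_trapezoid e0 ltr01; have b1 := L1n_derive1_trapezoid 1 e0.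
case: (L1n (trapezoid e 1)) fin a0 a1 => // a _; rewrite !lee_fin => a0 a1.
case: (L1n (derive1 (trapezoid e 1))) fin' b0 b1 => // b _; rewrite !lee_fin => b0 b1.
rewrite -mulrA ler_wpM2l// mulrC.
apply: ler_pM; rewrite ?powR_ge0//.
  by apply: ge0_ler_powR => //; rewrite ?nnegrE// ltW.
(* As [1 + e >= 1], lowering the exponent to [1 - k] only decreases the power; the bound becomes
   affine in [e], the form required by [sharp_limit]. *)
apply: (@le_trans _ _ ((1 + e) `^ (1 - k))).
  by apply: ge0_ler_powR; rewrite ?nnegrE ?(ltW k10) ?addr_ge0// ltW.
by apply: ler1_powR; rewrite ?lerDl ?gerBl ltW.
Qed.

End sharpness.

Theorem corollary6 (R : realType) (k h : R) (n : nat)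
    (k_gt0 : 0 < k) (k_lt1 : k < 1) (kn : k < n%:R) (h_gt0 : 0 < h) :
  let A := 2 * h `^ (- k) / Gamma (1 - k) in
  let B := k * h `^ (1 - k) / Gamma (2 - k) in
  let C := 2 `^ (1 - k) / Gamma (2 - k) in
  [/\ additive_ineq k n A B,
      (forall A' B' : R, A' <= A -> B' <= B ->
         additive_ineq k n A' B' -> A' = A /\ B' = B),
      multiplicative_ineq k n C &
      (forall C' : R, C' < C -> ~ multiplicative_ineq k n C')].
Proof.
move=> A B C.
have n0 : (0 < n)%N by rewrite -(ltr0n R); exact: lt_trans kn.
have k10 : 0 < 1 - k by rewrite subr_gt0.
have k11 : 1 - k <= 1 by rewrite gerBl ltW.
have G0 := Gamma_gt0 k10 k11.
have GE : Gamma (2 - k) = (1 - k) * Gamma (1 - k).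
  by rewrite -Gamma_rec//; congr Gamma; ring.
have A0 : 0 < A by rewrite divr_gt0// mulr_gt0// powR_gt0.
have B0 : 0 < B by rewrite /B GE divr_gt0// mulr_gt0// powR_gt0.
have C0 : 0 < C by rewrite /C GE divr_gt0 ?powR_gt0// mulr_gt0.
split.
- exact: additive_marchaud.
- move=> A' B' AA BB H.
  (* The competing constants may be negative. Raising them to 0 keeps the inequality valid, the
     norms being nonnegative. *)
  have H' : additive_ineq k n (Num.max A' 0) (Num.max B' 0).
    move=> f f11; apply: le_trans (H f f11) _.
    rewrite !L1norm_EFin; apply: leeD; apply: lee_wpmul2r; rewrite ?L1n_ge0// lee_fin;
    by rewrite le_max lexx.
  have := additive_ineq_lower k_gt0 k_lt1 n0 h_gt0 _ _ H'.
  rewrite !le_max !lexx !orbT => /(_ isT isT).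
  (* The trapezoid limit coincides with the upper bound, by [1 + k / (1 - k) = 1 / (1 - k)]. With no
     slack left in [A h + 2 B], neither constant can be lowered. *)
  have -> : 2 * h `^ (1 - k) / Gamma (2 - k) = A * h + B * 2.
    rewrite /A /B GE !powR1B//; field.
    by rewrite !gt_eqF.
  move=> L.
  have A1 : Num.max A' 0 <= A by rewrite ge_max AA ltW.
  have B1 : Num.max B' 0 <= B by rewrite ge_max BB ltW.
  have A2 : A <= Num.max A' 0.
    have : (A - Num.max A' 0) * h <= 0 by rewrite mulrBl; lra.
    by rewrite pmulr_lle0// subr_le0.
  have B2 : B <= Num.max B' 0.
    have := ler_wpM2r (ltW h_gt0) A1; lra.
  split; apply/le_anti.
    (* Positivity of [A] rules out that the maximum is attained by 0, so the bound falls on [A']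
       itself. *)
    by rewrite AA/=; move: A2; rewrite le_max => /orP[//|]; rewrite leNgt A0.
  by rewrite BB/=; move: B2; rewrite le_max => /orP[//|]; rewrite leNgt B0.
- exact: multiplicative_marchaud.
- move=> C' CC H.
  have H' : multiplicative_ineq k n (Num.max C' 0).
    move=> f f11; apply: le_trans (H f f11) _.
    apply: lee_wpmul2r; first by rewrite mule_ge0 ?poweR_ge0.
    by rewrite lee_fin le_max lexx.
  have C'0 : 0 <= Num.max C' 0 by rewrite le_max lexx orbT.
  have := multiplicative_ineq_lower k_gt0 k_lt1 n0 C'0 H'.
  have -> : 2 / Gamma (2 - k) = C * 2 `^ k.
    rewrite /C mulrAC -powRD ?pnatr_eq0 ?implybT//.
    by rewrite subrK powRr1.
  rewrite ler_pM2r ?powR_gt0// leNgt => /negP; apply.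
  by rewrite gt_max CC.
Qed.
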